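(* Let $G$ be a group and let $\mathcal{P}$ be a finite collection of subgroups of $G$. Then $G$ is hyperbolic relative to $\mathcal{P}$ if and only if there is a $1$-acyclic $G$-complex $X$ such that (1) the $G$-action on $X$ is cocompact; (2) there is $C\ge 0$ such that $FV_{X,\mathbb{Z}}(k)\le Ck$ for every $k$; (3) the $G$-stabilizers of $1$-cells of $X$ are finite; and (4) $\mathcal{P}$ is a collection of representatives of distinct conjugacy classes of $G$-stabilizers of $0$-cells of $X$ such that each infinite stabilizer is represented.
   Context: All complexes are combinatorial cell complexes and all maps are combinatorial, in the sense of Bridson--Haefliger (Chapter I.8, Appendix): a combinatorial map is continuous and restricts to a homeomorphism from each open cell onto an open cell, and attaching maps of cells are combinatorial for a suitable cell structure on the sphere; in particular each $2$-cell is attached along a closed edge path. All group actions on complexes are by combinatorial maps; a $G$-complex is a complex with such an action of $G$, and the action is cocompact if there are finitely many $G$-orbits of cells. A complex is $1$-acyclic if it is connected and its first homology group over $\mathbb{Z}$ is trivial. A graph is a $1$-dimensional combinatorial complex (loops and multiple edges allowed). A circuit is a simple closed combinatorial path. A graph $\Gamma$ is fine if for every edge $e$ and each integer $L>0$, the number of circuits of length at most $L$ which contain $e$ is finite. Relative hyperbolicity (Bowditch): $G$ is hyperbolic relative to a finite collection of subgroups $\mathcal{P}$ if $G$ acts on a connected, fine, $\delta$-hyperbolic graph $\Gamma$ (Gromov hyperbolic for the path metric with edges of length $1$) with finite edge stabilizers and finitely many orbits of edges, and $\mathcal{P}$ is a set of representatives of distinct conjugacy classes of vertex stabilizers such that each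 infinite stabilizer is represented. The group $G$ is not assumed finitely generated and nothing is assumed on the subgroups in $\mathcal{P}$. For a complex $X$, an orientation is fixed for each cell of positive dimension, so $C_i(X,\mathbb{Z})$ (cellular $i$-chains) is the free abelian group on the $i$-cells; $\|\cdot\|_1$ is the $\ell_1$-norm in this basis, and $Z_1(X,\mathbb{Z})$ is the group of cellular $1$-cycles. For $\gamma\in Z_1(X,\mathbb{Z})$ set $\|\gamma\|_{\partial,\mathbb{Z}}=\inf\{\|\mu\|_1:\mu\in C_2(X,\mathbb{Z}),\ \partial\mu=\gamma\}$, with $\inf\emptyset=\infty$. The homological Dehn function of $X$ over $\mathbb{Z}$ is $FV_{X,\mathbb{Z}}(k)=\sup\{\|\gamma\|_{\partial,\mathbb{Z}}:\gamma\in Z_1(X,\mathbb{Z}),\ \|\gamma\|_1\le k\}$ for $k\in\mathbb{N}$, with $\sup\emptyset=0$. *)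

(* Defs.v *)
From HB Require Import structures.
From mathcomp Require Import all_boot all_order all_algebra.
From mathcomp Require Import all_classical all_reals all_analysis.
Import Order.TTheory GRing.Theory Num.Theory.
Import numFieldNormedType.Exports.

Set Implicit Arguments.
Unset Strict Implicit.
Unset Printing Implicit Defensive.

Local Open Scope classical_set_scope.
Local Open Scope ring_scope.

(** Combinatorial cell complexes.

    A combinatorial complex is encoded by its cells, graded by dimension, and
    by its incidences (its small category without loops, Bridson--Haefliger
    III.C.1).  An incidence [a] with [high a = s] and [low a = t] is an open
    cell of the cell structure on the sphere along which [s] is attached,
    mapped by the attaching map onto the open cell [t]; the same [t] may occur
    several times in the boundary of [s].  If [high a = low b] then [icomp a b]
    is [a] seen, through [b], in the boundary of [high b]; the value of [icomp]
    on other pairs is junk.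

    The orientations are part of the data.  For [e] a 1-cell, [pos a] says
    that the incidence [a] into [e] is the head of [e] (as opposed to its
    tail); for [f] a 2-cell, [pos b] says that the side [b] of [f] is
    traversed from tail to head.  Other values of [pos] are unused. *)
Record cellData := CellData {
  cell : choiceType;
  dim : cell -> nat;
  inc : choiceType;
  low : inc -> cell;
  high : inc -> cell;
  icomp : inc -> inc -> inc;
  pos : inc -> bool }.

Section ComplexAxioms.
Variables (R : realType) (X : cellData).
Implicit Types (a b : inc X) (e f s t : cell X).

(** The boundary of a 1-cell is a 0-sphere: one tail and one head. *)
Definition edge_boundary e : Prop :=
  exists a0 a1, [/\ [set a | high a = e] = [set a0; a1],
    pos a0 = false & pos a1 = true].

(** The boundary of a 2-cell is an [n]-gon, [0 < n], with corners [c i] and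
    with sides [b i] from [c i] to [c (i + 1)], indices modulo [n]. *)
Definition face_boundary f : Prop :=
  exists n (b c : 'I_n -> inc X),
  [/\ (0 < n)%N,
      injective b /\ range b = [set x | high x = f /\ dim (low x) = 1%N],
      injective c /\ range c = [set x | high x = f /\ dim (low x) = 0%N] &
      forall i a, high a = low (b i) ->
        icomp a (b i) = c (if pos a == pos (b i) then ordS i else i)].

Definition sqnorm k (x : 'rV[R]_k) : R := \sum_(i < k) x 0 i ^+ 2.
Definition disc k : set 'rV[R]_k := [set x | sqnorm x <= 1].
Definition open_disc k : set 'rV[R]_k := [set x | sqnorm x < 1].
Definition sphere k : set 'rV[R]_k := [set x | sqnorm x = 1].
Arguments disc : clear implicits.
Arguments open_disc : clear implicits.
Arguments sphere : clear implicits.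

(** The boundary of [s] is a combinatorial cell structure on a sphere: one can
    choose a closed disc for [s] and for each cell in its boundary, and a
    continuous map [H a] from the disc of [low a] to the boundary of the disc
    of [high a] for each incidence [a] between them, compatibly with
    composition and such that each boundary sphere is partitioned by the
    homeomorphic images of the open discs of its cells.  ([H a] takes the two
    dimensions as arguments in order to avoid casts.) *)
Definition sphere_boundary s : Prop :=
  let below t := t = s \/ exists a, low a = t /\ high a = s in
  exists H : inc X -> forall k m, 'rV[R]_k -> 'rV[R]_m,
  let F a := H a (dim (low a)) (dim (high a)) in
  [/\ forall a, below (high a) ->
        [/\ {within disc (dim (low a)), continuous (F a)},
            F a @` disc (dim (low a)) `<=` sphere (dim (high a)) &
            set_inj (open_disc (dim (low a))) (F a)],
      forall a b, high a = low b -> below (high b) ->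
        forall x, disc (dim (low a)) x ->
          H (icomp a b) (dim (low a)) (dim (high b)) x =
          F b (H a (dim (low a)) (dim (low b)) x) &
      forall t, below t ->
        let G a := H a (dim (low a)) (dim t) in
        sphere (dim t) =
          \bigcup_(a in [set a | high a = t]) G a @` open_disc (dim (low a)) /\
        trivIset [set a | high a = t]
          (fun a => G a @` open_disc (dim (low a)))].

Record is_complex : Prop := IsComplex {
  dim_lt : forall a, (dim (low a) < dim (high a))%N;
  finite_boundary : forall s, finite_set [set a | high a = s];
  low_comp : forall a b, high a = low b -> low (icomp a b) = low a;
  high_comp : forall a b, high a = low b -> high (icomp a b) = high b;
  comp_assoc : forall a b c, high a = low b -> high b = low c ->
    icomp (icomp a b) c = icomp a (icomp b c);
  boundary1 : forall e, dim e = 1%N -> edge_boundary e;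
  boundary2 : forall f, dim f = 2%N -> face_boundary f;
  boundary3 : forall s, (3 <= dim s)%N -> sphere_boundary s }.

End ComplexAxioms.

Record complex (R : realType) := Complex {
  cells :> cellData;
  complexP : is_complex R cells }.

Section Actions.
Variables (R : realType) (G : groupType) (X : complex R).

(** An action by combinatorial maps.  Besides permuting the cells, a
    combinatorial automorphism induces combinatorial isomorphisms between
    boundary spheres (it may invert an edge, or rotate or reflect a 2-cell),
    whence the action on incidences.  Orientations need not be preserved. *)
Record action := Action {
  act : G -> cell X -> cell X;
  acti : G -> inc X -> inc X;
  act1 : forall c, act 1%g c = c;
  actM : forall g h c, act (g * h)%g c = act g (act h c);
  acti1 : forall a, acti 1%g a = a;
  actiM : forall g h a, acti (g * h)%g a = acti g (acti h a);
  act_dim : forall g c, dim (act g c) = dim c;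
  act_low : forall g a, low (acti g a) = act g (low a);
  act_high : forall g a, high (acti g a) = act g (high a);
  act_comp : forall g a b, high a = low b ->
    acti g (icomp a b) = icomp (acti g a) (acti g b) }.

Variable A : action.

Definition stab (c : cell X) : set G := [set g | act A g c = c].
Definition orbit (c : cell X) : set (cell X) := [set act A g c | g in setT].

Definition cocompact : Prop := finite_set [set orbit c | c in setT].

Definition finite_edge_stabilizers : Prop :=
  forall e : cell X, dim e = 1%N -> finite_set (stab e).

Definition finitely_many_edge_orbits : Prop :=
  finite_set [set orbit e | e in [set e | dim e = 1%N]].

End Actions.

Section Subgroups.
Variable G : groupType.

Definition is_subgroup (H : set G) : Prop := group_closed [in H].

Definition conjugate (H K : set G) : Prop :=
  exists g : G, K = [set (g * h * g^-1)%g | h in H].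

(** [P] consists of representatives of distinct conjugacy classes of
    stabilizers of 0-cells, and each infinite stabilizer is represented.  (A
    subgroup conjugate to the stabilizer of a 0-cell is itself the stabilizer
    of a 0-cell.) *)
Definition represents_vertex_stabilizers (R : realType) (X : complex R)
    (A : action G X) (P : set (set G)) : Prop :=
  [/\ forall H, P H -> exists2 v, dim v = 0%N & H = stab A v,
      forall H K, P H -> P K -> conjugate H K -> H = K &
      forall v, dim v = 0%N -> infinite_set (stab A v) ->
        exists2 H, P H & conjugate H (stab A v)].

End Subgroups.

Section Paths.
Variables (R : realType) (X : complex R).

(** An oriented edge: the two incidences into a 1-cell, initial one first. *)
Definition dart (d : inc X * inc X) : bool :=
  [&& dim (high d.1) == 1%N, high d.1 == high d.2 & d.1 != d.2].
Definition dsrc (d : inc X * inc X) : cell X := low d.1.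
Definition dtgt (d : inc X * inc X) : cell X := low d.2.
Definition dedge (d : inc X * inc X) : cell X := high d.1.

Fixpoint walk (v : cell X) (p : seq (inc X * inc X)) (w : cell X) : Prop :=
  if p is d :: q then [/\ dart d, dsrc d = v & walk (dtgt d) q w] else v = w.

Definition connected_complex : Prop :=
  (exists v : cell X, dim v = 0%N) /\
  forall v w : cell X, dim v = 0%N -> dim w = 0%N -> exists p, walk v p w.

(** A combinatorially embedded cycle; distinctness of the edges excludes the
    closed path that goes along an edge and back. *)
Definition circuit (p : seq (inc X * inc X)) : bool :=
  [&& (0 < size p)%N, all dart p, cycle (fun d d' => dtgt d == dsrc d') p,
      uniq (map dsrc p) & uniq (map dedge p)].

Definition fine_graph : Prop :=
  forall (e : cell X) (L : nat), dim e = 1%N -> (0 < L)%N ->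
    finite_set [set p | [&& circuit p, (size p <= L)%N & e \in map dedge p]].

Definition is_graph : Prop := forall c : cell X, (dim c <= 1)%N.

(** Points of the metric graph: [(v, t)] is the 0-cell [v] whatever [t], and
    [(e, t)] is the point of the 1-cell [e] at distance [t] from its tail. *)
Definition point : set (cell X * R) :=
  [set x | (dim x.1 <= 1)%N /\ 0 <= x.2 <= 1].

(** [l] is the length of a segment from [x] to [v] in a closed cell. *)
Definition to_vertex (x : cell X * R) (v : cell X) (l : R) : Prop :=
  (dim x.1 = 0%N /\ v = x.1 /\ l = 0) \/
  (dim x.1 = 1%N /\ exists2 a, high a = x.1 /\ low a = v &
     l = if pos a then 1 - x.2 else x.2).

(** The path metric, with edges of length 1. *)
Definition path_dist (x y : cell X * R) : R :=
  inf ([set l | exists v w p l1 l2, [/\ to_vertex x v l1, to_vertex y w l2,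
                  walk v p w & l = l1 + (size p)%:R + l2]] `|`
       [set l | [/\ x.1 = y.1, dim x.1 = 1%N & l = `|x.2 - y.2|]]).

Definition gromov_product (x y w : cell X * R) : R :=
  (path_dist x w + path_dist y w - path_dist x y) / 2.

Definition gromov_hyperbolic (delta : R) : Prop :=
  forall x y z w, point x -> point y -> point z -> point w ->
    Num.min (gromov_product x y w) (gromov_product y z w) - delta <=
    gromov_product x z w.

End Paths.

Definition relatively_hyperbolic (R : realType) (G : groupType)
    (P : set (set G)) : Prop :=
  exists (Gamma : complex R) (A : action G Gamma),
  [/\ is_graph Gamma /\ connected_complex Gamma, fine_graph Gamma,
      exists2 delta : R, 0 <= delta & gromov_hyperbolic Gamma delta,
      finite_edge_stabilizers A /\ finitely_many_edge_orbits A &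
      represents_vertex_stabilizers A P].

Section Homology.
Variables (R : realType) (X : complex R).

(** Cellular [i]-chains, as finitely supported functions on the [i]-cells
    extended by zero to all cells. *)
Definition chain (i : nat) : set (cell X -> int) :=
  [set mu | finite_set [set c | mu c != 0] /\
            forall c, mu c != 0 -> dim c = i].

(** Meaningful on [1]- and [2]-chains only. *)
Definition bd (mu : cell X -> int) (c : cell X) : int :=
  \sum_(a \in [set a | low a = c /\ dim (high a) = (dim c).+1])
    (if pos a then mu (high a) else - mu (high a)).

Definition cycle1 : set (cell X -> int) :=
  [set gamma | chain 1 gamma /\ forall c, bd gamma c = 0].

Definition one_acyclic : Prop :=
  connected_complex X /\
  forall gamma, cycle1 gamma -> exists2 mu, chain 2 mu & bd mu = gamma.

Definition l1norm (mu : cell X -> int) : nat :=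
  \sum_(c \in [set: cell X]) `|mu c|%N.

Definition filling_norm (gamma : cell X -> int) : \bar R :=
  ereal_inf [set (l1norm mu)%:R%:E | mu in [set mu | chain 2 mu /\
                                                     bd mu = gamma]].

(** The set is never empty: it contains the filling norm of 0. *)
Definition FV (k : nat) : \bar R :=
  ereal_sup [set filling_norm gamma | gamma in
              [set gamma | cycle1 gamma /\ (l1norm gamma <= k)%N]].

End Homology.

(* Main.v *)
From Pilot Require Import Defs.
From HB Require Import structures.
From mathcomp Require Import all_boot all_order all_algebra.
From mathcomp Require Import all_classical all_reals all_analysis.
From mathcomp Require Import finmap zify ring lra.
Import Order.TTheory GRing.Theory Num.Theory.
Import Pilot.Defs.
(** Both directions go through one property of a graph: the chain of every
    closed walk of length [n] is a sum of at most [C n] chains of closed walks of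
    bounded length ([fills]).  On the side of the complex, 2-chains are lists of
    boundary walks of 2-cells, and 1-cycles are sums of closed walks of the same
    total length ([cycle1_closed_walks], an Eulerian decomposition); so linear
    fillings of closed walks are the same as a linear bound on the homological
    Dehn function.  The chains of closed walks, unlike the walks, can be cut and
    rearranged freely.

    From a fine hyperbolic graph to a complex: by the four-point condition a
    closed walk has a non-geodesic subwalk of bounded length
    ([closed_walk_shortcut]), since the distance from the base point would grow
    forever along a local geodesic.  Replacing such subwalks by shorter ones
    fills closed walks linearly by closed walks of bounded length, and cutting
    the latter at repeated vertices leaves circuits of length at most [L]
    ([four_point_fills_circuits]).  Hence the complex obtained by attaching a
    2-cell along each circuit of length at most [L] is 1-acyclic with linear
    Dehn function.  Fineness leaves finitely many orbits of these circuits
    ([circuit_complex_cocompact]).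

    From a complex to its 1-skeleton, hyperbolicity ([fills_four_point]): let
    [p] be a point of a geodesic from [a] to [b] and close the geodesic by a path
    that stays at distance [D] from [p].  The 1-cochain [h dg], where [g] is the
    distance from [a] and [h] is a bump function of height [D] around [p], takes
    a value of order [D ^ 2] on the loop and a bounded value on the boundary of
    each face.  As the loop bounds linearly many faces, its length is at least
    of order [D ^ 2] ([far_is_long]).  In a geodesic triangle with the worst
    slimness constant [D] for its perimeter one can construct such a loop of
    length at most [30 D] ([slim_step]); therefore [D] is bounded, and slim
    triangles give the four-point condition ([slim_four_point]).

    Fineness of the 1-skeleton ([fills_fine]): cocompactness and finite edge
    stabilizers leave finitely many faces at each edge.  A circuit of length at
    most [L] bounds a bounded number of faces; those that can be reached from an
    edge [e] of the circuit bound a cycle carried by part of the circuit, which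
    is then all of it.  So the circuit lies in a finite ball around [e]
    ([circuit_in_ball]). *)

Set Implicit Arguments.
Unset Strict Implicit.
Unset Printing Implicit Defensive.
Local Open Scope classical_set_scope.
Local Open Scope ring_scope.

(** * Walks and their chains *)

Section Walks.
Variables (R : realType) (X : complex R).
Local Notation dartT := (inc X * inc X)%type.
Implicit Types (a b : inc X) (e v w x : cell X) (d : dartT) (p q s : seq dartT).

Lemma low_dim0 a : dim (high a) = 1%N -> dim (low a) = 0%N.
Proof. by have := dim_lt (complexP X) a; lia. Qed.

Lemma inc_pos_inj a b :
  dim (high a) = 1%N -> high a = high b -> pos a = pos b -> a = b.
Proof.
move=> da hab; have [a0 [a1 [E p0 p1]]] := boundary1 (complexP X) da.
have /= : [set a0; a1] a by rewrite -E.
have /= : [set a0; a1] b by rewrite -E /= -hab.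
by move=> [->|->] [->|->] //; rewrite p0 p1.
Qed.

Lemma edge_ends e : dim e = 1%N -> exists a0 a1,
  [/\ high a0 = e, high a1 = e, pos a0 = false, pos a1 = true &
      forall a, high a = e -> a = a0 \/ a = a1].
Proof.
move=> de; have [a0 [a1 [E p0 p1]]] := boundary1 (complexP X) de.
exists a0, a1; split => //.
- by have : [set a0; a1] a0 by [left]; rewrite -E.
- by have : [set a0; a1] a1 by [right]; rewrite -E.
- by move=> a ha; have : [set a | high a = e] a by []; rewrite E.
Qed.

Lemma dartP d : dart d ->
  [/\ dim (high d.1) = 1%N, high d.1 = high d.2 & d.1 <> d.2].
Proof. by case/and3P => /eqP ? /eqP ? /eqP. Qed.

Lemma dart_pos d : dart d -> pos d.1 = ~~ pos d.2.
Proof.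
move=> /dartP[d1 h12 n12].
case E1 : (pos d.1); case E2 : (pos d.2) => //; case: n12;
  by apply: inc_pos_inj; rewrite // E1 E2.
Qed.

Lemma dsrc_dim d : dart d -> dim (dsrc d) = 0%N.
Proof. by move=> /dartP[d1 _ _]; apply: low_dim0. Qed.

Lemma dtgt_dim d : dart d -> dim (dtgt d) = 0%N.
Proof. by move=> /dartP[d1 h _]; apply: low_dim0; rewrite -h. Qed.

Definition rdart d : dartT := (d.2, d.1).

Lemma dart_rdart d : dart d -> dart (rdart d).
Proof.
move=> /dartP[d1 h12 n12]; rewrite /dart /= -h12 d1 !eqxx /=.
by apply/eqP => /esym.
Qed.

Lemma dedge_rdart d : dart d -> dedge (rdart d) = dedge d.
Proof. by move=> /dartP[]. Qed.

Lemma dart_same_edge d d' : dart d -> dart d' -> dedge d = dedge d' ->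
  d' = d \/ d' = rdart d.
Proof.
move=> D D' E; have [d1 h12 _] := dartP D; have [d1' h12' _] := dartP D'.
have P := dart_pos D; have P' := dart_pos D'.
case: d d' {D D'} E d1 h12 d1' h12' P P' => [a b] [a' b'].
rewrite /dedge /rdart /= => E d1 h12 d1' h12' P P'.
have [Q|Q] := eqVneq (pos a) (pos a').
  left; congr pair; symmetry; apply: inc_pos_inj => //; first by rewrite -h12.
    by rewrite -h12 E.
  by move: P P'; rewrite Q => -> /negb_inj.
right; congr pair; apply: inc_pos_inj; rewrite -?h12' -?E //.
  by move: P P' Q; do 4!case: (pos _).
by move: P P' Q; do 4!case: (pos _).
Qed.

Lemma walk_cat u p q w :
  walk u (p ++ q) w <-> exists v, walk u p v /\ walk v q w.
Proof.
elim: p u => [|d p IH] u /=.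
  by split=> [W|[v [<- //]]]; exists u.
split=> [[D S /IH[v [W1 W2]]]|[v [[D S W1] W2]]].
  by exists v.
by split=> //; apply/IH; exists v.
Qed.

Lemma walk_darts u p w : walk u p w -> all (@dart _ X) p.
Proof. by elim: p u => [|d p IH] u //= [-> _ /IH ->]. Qed.

Lemma walk_end_inj u p v w : walk u p v -> walk u p w -> v = w.
Proof. by elim: p u => [|d p IH] u /= => [<- <-|[_ _ /IH K] [_ _ /K]]. Qed.

Definition rwalk p := rev (map rdart p).

Lemma size_rwalk p : size (rwalk p) = size p.
Proof. by rewrite size_rev size_map. Qed.

Lemma rwalk_cons d p : rwalk (d :: p) = rwalk p ++ [:: rdart d].
Proof. by rewrite /rwalk /= rev_cons -cats1. Qed.

Lemma walk_rwalk u p w : walk u p w -> walk w (rwalk p) u.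
Proof.
elim: p u => [|d p IH] u /=; first by move=> ->.
move=> [D S W]; rewrite rwalk_cons; apply/walk_cat; exists (dtgt d).
by split; [exact: IH|split => //; exact: dart_rdart].
Qed.

Lemma walk_end_dim u p w : walk u p w -> dim u = 0%N -> dim w = 0%N.
Proof.
elim: p u => [|d p IH] u /=; first by move=> ->.
by move=> [D _ /IH] E _; apply: E; apply: dtgt_dim.
Qed.

(** The coefficient of a dart in the cellular chain of its 1-cell, which is
    oriented towards the end with [pos]. *)
Definition sgn d : int := if pos d.2 then 1 else -1.

Lemma sgn_rdart d : dart d -> sgn (rdart d) = - sgn d.
Proof. by move=> /dart_pos E; rewrite /sgn /= E; case: (pos d.2); rewrite ?opprK. Qed.

Definition wchain p e : int := \sum_(d <- p) (if dedge d == e then sgn d else 0).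

Lemma wchain_cat p q e : wchain (p ++ q) e = wchain p e + wchain q e.
Proof. by rewrite /wchain big_cat. Qed.

Lemma wchain_cons d p e :
  wchain (d :: p) e = (if dedge d == e then sgn d else 0) + wchain p e.
Proof. by rewrite /wchain big_cons. Qed.

Lemma wchain_nil e : wchain [::] e = 0.
Proof. by rewrite /wchain big_nil. Qed.

Lemma wchain_rwalk p e : all (@dart _ X) p -> wchain (rwalk p) e = - wchain p e.
Proof.
elim: p => [|d p IH] /=; first by rewrite wchain_nil oppr0.
move=> /andP[D A]; rewrite rwalk_cons wchain_cat IH // !wchain_cons wchain_nil addr0.
by rewrite dedge_rdart // sgn_rdart // opprD addrC; case: ifP; rewrite // oppr0.
Qed.

Lemma wchain_perm p q e : perm_eq p q -> wchain p e = wchain q e.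
Proof. by move=> pq; apply: perm_big. Qed.

Lemma wchain_flatten (ws : seq (seq dartT)) e :
  wchain (flatten ws) e = \sum_(q <- ws) wchain q e.
Proof.
by elim: ws => [|q ws IH] /=; rewrite ?big_nil ?wchain_nil // wchain_cat big_cons IH.
Qed.

Lemma wchain_notin p e : e \notin map (@dedge _ X) p -> wchain p e = 0.
Proof.
elim: p => [|d p IH] /=; first by rewrite wchain_nil.
rewrite inE negb_or => /andP[/negbTE N /IH E].
by rewrite wchain_cons eq_sym N E add0r.
Qed.

(** The value of the 1-cochain [phi] on the chain of [p]. *)
Definition wval (phi : cell X -> int) p : int := \sum_(d <- p) sgn d * phi (dedge d).

Lemma wvalE phi p (E : seq (cell X)) : uniq E ->
  {subset map (@dedge _ X) p <= E} ->
  wval phi p = \sum_(e <- E) phi e * wchain p e.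
Proof.
move=> uE; elim: p => [|d p IH] sE.
  by rewrite /wval big_nil big1 // => e _; rewrite wchain_nil mulr0.
rewrite /wval big_cons -/(wval phi p) IH; last first.
  by move=> e He; apply: sE; rewrite inE He orbT.
under [RHS]eq_bigr => e _ do rewrite wchain_cons mulrDr.
rewrite big_split /=; congr (_ + _).
rewrite (bigD1_seq (dedge d)) //=; last by apply: sE; rewrite inE eqxx.
rewrite eqxx mulrC big1 ?addr0 // => e; rewrite eq_sym => /negbTE ->.
by rewrite mulr0.
Qed.

(** Chains determine the pairing, so that a cochain which is small on every
    walk of [s] is small on any walk whose chain is a sum of those of [s]. *)
Lemma wval_sum phi p (s : seq (seq dartT)) :
  (forall e, wchain p e = \sum_(q <- s) wchain q e) ->
  wval phi p = \sum_(q <- s) wval phi q.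
Proof.
move=> H; pose E := undup (map (@dedge _ X) (p ++ flatten s)).
rewrite (@wvalE phi p E) ?undup_uniq //; last first.
  by move=> e He; rewrite mem_undup map_cat mem_cat He.
have HE q : q \in s -> wval phi q = \sum_(e <- E) phi e * wchain q e.
  move=> qs; apply: wvalE; rewrite ?undup_uniq // => e /mapP[d dq ->].
  rewrite mem_undup map_cat mem_cat; apply/orP; right; apply: map_f.
  by apply/flattenP; exists q.
rewrite (eq_big_seq _ HE) exchange_big /=; apply: eq_bigr => e _.
by rewrite H mulr_sumr.
Qed.

(** A filling that only remembers the boundaries of its faces: the list [s]
    plays the role of an integral 2-chain of norm at most [n], each face being
    listed as often as its coefficient says, reversed if this is negative. *)
Definition fills (B : seq dartT -> Prop) (n : nat) p : Prop :=
  exists s : seq (seq dartT), [/\ (size s <= n)%N, forall q, q \in s -> B q &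
    forall e, wchain p e = \sum_(q <- s) wchain q e].

Lemma fills0 B n p : (forall e, wchain p e = 0) -> fills B n p.
Proof. by move=> H; exists [::]; split=> // e; rewrite big_nil. Qed.

Lemma fills1 (B : seq dartT -> Prop) p : B p -> fills B 1 p.
Proof.
move=> Bp; exists [:: p]; split=> // [q|e]; first by rewrite inE => /eqP ->.
by rewrite big_seq1.
Qed.

Lemma fills_add (B : seq dartT -> Prop) n1 n2 p p1 p2 :
  (forall e, wchain p e = wchain p1 e + wchain p2 e) ->
  fills B n1 p1 -> fills B n2 p2 -> fills B (n1 + n2) p.
Proof.
move=> H [s1 [z1 b1 c1]] [s2 [z2 b2 c2]]; exists (s1 ++ s2); split.
- by rewrite size_cat leq_add.
- by move=> q; rewrite mem_cat => /orP[/b1|/b2].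
- by move=> e; rewrite H c1 c2 big_cat.
Qed.

Lemma fills_le (B : seq dartT -> Prop) n m p :
  (n <= m)%N -> fills B n p -> fills B m p.
Proof. by move=> nm [s [z b c]]; exists s; split=> //; apply: leq_trans nm. Qed.

Lemma fills_sub (B B' : seq dartT -> Prop) n p :
  (forall q, B q -> B' q) -> fills B n p -> fills B' n p.
Proof. by move=> BB [s [z b c]]; exists s; split=> // q /b /BB. Qed.

Lemma fills_trans (B B' : seq dartT -> Prop) n m p :
  (forall q, B q -> fills B' m q) -> fills B n p -> fills B' (n * m) p.
Proof.
move=> H [s [z b c]]; apply: (@fills_le _ (size s * m)); first by rewrite leq_mul2r z orbT.
elim: s p b c {z} => [|q s IH] p b c.
  by apply: fills0 => e; rewrite c big_nil.
rewrite mulSn; apply: (@fills_add _ _ _ _ q (flatten s)).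
- by move=> e; rewrite c big_cons wchain_flatten.
- by apply/H/b; rewrite inE eqxx.
- apply: IH => [q' q's|e]; first by apply: b; rewrite inE q's orbT.
  by rewrite wchain_flatten.
Qed.

Lemma walk_count u p w x : walk u p w ->
  (count (fun d => dsrc d == x) p + (w == x) =
   count (fun d => dtgt d == x) p + (u == x))%N.
Proof.
elim: p u => [|d p IH] u /=; first by move=> ->.
by move=> [D <- /IH]; lia.
Qed.

(** Greedy Eulerian argument: a trail that does not close up can be extended,
    since at its end more chosen darts have been entered than left. *)
Lemma euler_extend n s p u w :
  (size s <= n)%N -> all (@dart _ X) s -> walk u p w ->
  (forall x, count (fun d => dsrc d == x) (p ++ s) =
             count (fun d => dtgt d == x) (p ++ s)) ->
  exists ws : seq (seq dartT),
    (forall q, q \in ws -> exists v, walk v q v) /\ perm_eq (p ++ s) (flatten ws).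
Proof.
elim: n s p u w => [|n IH] s p u w.
  rewrite leqn0 => /nilP -> _ W B; exists [:: p]; split; last by rewrite /= !cats0.
  move=> q; rewrite inE => /eqP ->; exists u.
  have := walk_count w W; have := B w; rewrite !cats0 eqxx => ->.
  by case: (eqVneq u w) => [E _|_]; [rewrite [in X in walk _ _ X]E | lia].
move=> zs ds W B.
have [E|N] := eqVneq u w.
  subst w; case: s zs ds B => [|d s] zs ds B.
    exists [:: p]; split; last by rewrite /= !cats0.
    by move=> q; rewrite inE => /eqP ->; exists u.
  have /andP[Dd Ds] := ds.
  have [|//|/=||ws [H1 H2]] := IH s [:: d] (dsrc d) (dtgt d).
  - exact: zs.
  - by split.
  - move=> x; have := walk_count x W; have := B x; rewrite !count_cat.
    by lia.
  exists (p :: ws); split; last by rewrite /= perm_cat2l.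
  by move=> q; rewrite inE => /orP[/eqP ->|/H1]; first by exists u.
have : has (fun d => dsrc d == w) s.
  rewrite has_count; have := walk_count w W; have := B w.
  by rewrite !count_cat eqxx (negbTE N); lia.
case/hasP => d sd /eqP dw.
have Ps := perm_to_rem sd.
have [||||ws [H1 H2]] := IH (rem d s) (p ++ [:: d]) u (dtgt d).
- by rewrite size_rem //; case: (size s) zs.
- by apply/allP => d' /mem_rem; move/allP: ds; apply.
- by apply/walk_cat; exists w; split=> //=; split => //; move/allP: ds; apply.
- move=> x; rewrite -!catA !count_cat; have := B x; rewrite !count_cat.
  by rewrite (permP Ps) (permP Ps _) /=; lia.
exists ws; split=> //; apply: perm_trans H2.
by rewrite -catA perm_cat2l.
Qed.

(** A directed Eulerian multigraph decomposes into closed trails. *)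
Lemma euler_decomposition s : all (@dart _ X) s ->
  (forall x, count (fun d => dsrc d == x) s = count (fun d => dtgt d == x) s) ->
  exists ws : seq (seq dartT),
    (forall q, q \in ws -> exists v, walk v q v) /\ perm_eq s (flatten ws).
Proof.
case: s => [|d s] ds B; first by exists [::].
have /andP[Dd Ds] := ds.
have [//|//|/=|//|ws H] := @euler_extend (size s) s [:: d] (dsrc d) (dtgt d).
  by split.
by exists ws.
Qed.

End Walks.

(** * Closed walks and circuits *)

Lemma not_uniq_split (T U : eqType) (f : T -> U) (p : seq T) :
  ~~ uniq (map f p) ->
  exists p1 d p2 d' p3, p = p1 ++ d :: p2 ++ d' :: p3 /\ f d = f d'.
Proof.
elim: p => [|d p IH] //=; rewrite negb_and negbK => /orP[/mapP[d' dp E]|/IH].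
  by case/splitPr: dp => p2 p3; exists [::], d, p2, d', p3.
by move=> [p1 [e [p2 [e' [p3 [-> E]]]]]]; exists (d :: p1), e, p2, e', p3.
Qed.

Section Circuits.
Variables (R : realType) (X : complex R).
Local Notation dartT := (inc X * inc X)%type.
Implicit Types (u v w x y z : cell X) (d : dartT) (p q s : seq dartT).

Lemma walk_path u d p w : walk u (d :: p) w ->
  path (fun d d' => dtgt d == dsrc d') d p /\ dtgt (last d p) = w.
Proof.
elim: p u d => [|d' p IH] u d; first by move=> [_ _].
move=> [D S W]; have [P L] := IH _ _ W; split=> //.
by move: W => [_ E _]; apply/andP; split => //=; rewrite E.
Qed.

Lemma closed_walk_circuit v p : walk v p v -> (0 < size p)%N ->
  uniq (map (@dsrc _ X) p) -> uniq (map (@dedge _ X) p) -> circuit p.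
Proof.
move=> W s0 us ue; rewrite /circuit s0 us ue (walk_darts W) /= andbT.
case: p W {s0 us ue} => // d p W; have [P L] := walk_path W.
rewrite /cycle rcons_path P L; apply/eqP.
by move: W => [_ ->].
Qed.

(** Cut a closed walk at a repeated vertex.  When no vertex is repeated, an
    edge can only be repeated by a walk that goes along it and back. *)
Lemma closed_walk_fills_circuits n v p : walk v p v -> (size p <= n)%N ->
  fills (fun q => circuit q /\ (size q <= n)%N) (size p) p.
Proof.
have [k] := ubnP (size p); elim: k => // k IH in v p *; rewrite ltnS => pk W pn.
have [us|] := boolP (uniq (map (@dsrc _ X) p)); last first.
  move=> /not_uniq_split[p1 [d [p2 [d' [p3 [E S]]]]]].
  move: W; rewrite E => /walk_cat[u1 [W1 /= [D Su]]].
  move=> /walk_cat[u2 [W2 [D' Su' W3]]].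
  have E2 : u2 = u1 by rewrite -Su -Su'.
  move: pk pn; rewrite E !size_cat /= !size_cat /= => pk pn.
  apply: (@fills_le _ _ _ (size (d :: p2) + size (p1 ++ d' :: p3))).
    by rewrite size_cat /=; lia.
  apply: (@fills_add _ _ _ _ _ _ (d :: p2) (p1 ++ d' :: p3)).
  - by move=> e; rewrite !(wchain_cat, wchain_cons); ring.
  - apply: (IH u1) => /=; [lia| |lia].
    by split=> //; rewrite -E2.
  - apply: (IH v); rewrite ?size_cat /=; [lia| |lia].
    by apply/walk_cat; exists u1; split=> //; split=> //; rewrite Su'.
case: (posnP (size p)) => [/size0nil ->|s0].
  by apply: fills0 => e; rewrite wchain_nil.
have [ue|] := boolP (uniq (map (@dedge _ X) p)).
  apply: (@fills_le _ _ _ 1) => //; apply: fills1; split=> //.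
  exact: (closed_walk_circuit W).
move=> /not_uniq_split[p1 [d [p2 [d' [p3 [E S]]]]]].
move: W us; rewrite E => /walk_cat[u1 [W1 /= [D Su]]].
move=> /walk_cat[u2 [W2 [D' Su' W3]]].
rewrite map_cat cat_uniq /= map_cat /= => /and3P[_ N1 /andP[N2 U2]].
have [Ed|Ed] := dart_same_edge D D' S.
  by move: N2; rewrite Ed mem_cat inE eqxx orbT.
have S' : dsrc d' = dtgt d by rewrite Ed.
have T' : dtgt d' = dsrc d by rewrite Ed.
case: p2 W2 N1 N2 U2 E => [|d2 p2] W2 N1 N2 U2 E; last first.
  case: W2 => D2 S2 W2; move: U2; rewrite /= mem_cat inE.
  by rewrite S2 S' eqxx orbT.
case: p3 W3 N1 N2 U2 E => [|d3 p3] W3 N1 N2 U2 E; last first.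
  case: W3 => D3 S3 W3; move: N2; rewrite /= !inE.
  by rewrite S3 T' eqxx /= !orbT.
case: p1 W1 N1 E => [|d1 p1] W1 N1 E; last first.
  case: W1 => D1 S1 W1; move: N1; rewrite /= !inE S1 -W3 T'.
  by rewrite eqxx.
apply: fills0 => e; rewrite !wchain_cons wchain_nil Ed dedge_rdart // sgn_rdart //.
by case: ifP => _; ring.
Qed.

(** * The path metric on vertices *)

(** The least length of a walk; the default value [0] is never used in a
    connected complex. *)
Definition dist v w : nat := xget 0%N
  [set n | (exists p, walk v p w /\ size p = n) /\
           forall p, walk v p w -> (n <= size p)%N].

Hypothesis conX : connected_complex X.

Lemma dist_spec v w : dim v = 0%N -> dim w = 0%N ->
  (exists p, walk v p w /\ size p = dist v w) /\
  forall p, walk v p w -> (dist v w <= size p)%N.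
Proof.
move=> dv dw; rewrite /dist; case: xgetP => [n -> //|N]; exfalso.
have [p0 W0] := conX.2 v w dv dw.
pose Q n := `[< exists p, walk v p w /\ size p = n >].
have exQ : exists n, Q n by exists (size p0); apply/asboolP; exists p0.
have [n /asboolP[p [W E]] M] := ex_minnP exQ.
apply: (N n); split; first by exists p.
by move=> q Wq; apply: M; apply/asboolP; exists q.
Qed.

Lemma dist_walk v w : dim v = 0%N -> dim w = 0%N ->
  exists2 p, walk v p w & size p = dist v w.
Proof. by move=> dv dw; have [[p [W E]] _] := dist_spec dv dw; exists p. Qed.

Lemma dist_le v w p : dim v = 0%N -> walk v p w -> (dist v w <= size p)%N.
Proof. by move=> dv W; apply: (dist_spec dv (walk_end_dim W dv)).2. Qed.

Lemma dist_refl v : dim v = 0%N -> dist v v = 0%N.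
Proof. by move=> dv; apply/eqP; rewrite -leqn0; apply: (@dist_le v v [::]). Qed.

Lemma dist_sym v w : dim v = 0%N -> dim w = 0%N -> dist v w = dist w v.
Proof.
suff H a b : dim a = 0%N -> dim b = 0%N -> (dist a b <= dist b a)%N.
  by move=> dv dw; apply/eqP; rewrite eqn_leq !H.
move=> da db; have [p W <-] := dist_walk db da.
by rewrite -size_rwalk; apply: dist_le => //; apply: walk_rwalk.
Qed.

Lemma dist_triangle u v w : dim u = 0%N -> dim v = 0%N -> dim w = 0%N ->
  (dist u w <= dist u v + dist v w)%N.
Proof.
move=> du dv dw; have [p W1 <-] := dist_walk du dv.
have [q W2 <-] := dist_walk dv dw; rewrite -size_cat.
by apply: dist_le => //; apply/walk_cat; exists v.
Qed.

Lemma dist_step d : dart d -> (dist (dsrc d) (dtgt d) <= 1)%N.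
Proof.
by move=> D; apply: (@dist_le _ _ [:: d]) => //; apply: dsrc_dim.
Qed.

(** * From the four-point condition to linear fillings *)

(** Gromov's inequality with the products expanded and the base point [w] put
    on the same footing as the other points: of the three ways of pairing four
    points, the two largest sums differ by at most [D]. *)
Definition four_point (D : nat) : Prop := forall x y z w,
  dim x = 0%N -> dim y = 0%N -> dim z = 0%N -> dim w = 0%N ->
  (dist x z + dist y w <=
   maxn (dist x y + dist z w) (dist x w + dist y z) + D)%N.

(** Local geodesics do not close up.  If all subwalks of length at most
    [2 (D + 1)] are geodesic, let [x, y, z] be consecutive vertices at multiples
    of [D + 1] along the walk from [v].  Then [dist x z] is [D + 1] more than
    either of [dist x y] and [dist y z], so the four-point condition gives
    [dist v y + 1 <= max (dist v x) (dist v z)]: once the distance from [v] has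
    started to grow, it keeps growing. *)
Lemma closed_walk_shortcut D v p :
  four_point D -> dim v = 0%N -> walk v p v -> (D < size p)%N ->
  exists p1 p2 p3 x y, [/\ p = p1 ++ p2 ++ p3,
    [/\ walk v p1 x, walk x p2 y & walk y p3 v],
    (size p2 <= 2 * D.+1)%N & (dist x y < size p2)%N].
Proof.
move=> H dv W sp; apply: contrapT => N.
have geo p1 p2 p3 x y : p = p1 ++ p2 ++ p3 -> walk v p1 x -> walk x p2 y ->
    (size p2 <= 2 * D.+1)%N -> dist x y = size p2.
  move=> E W1 W2 s2; have dx := walk_end_dim W1 dv; have dy := walk_end_dim W2 dx.
  apply/eqP; rewrite eqn_leq dist_le //= leqNgt; apply/negP => L; apply: N.
  exists p1, p2, p3, x, y; split=> //; split=> //.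
  move: W; rewrite E => /walk_cat[x' [W1' /walk_cat[y' [W2' W3]]]].
  rewrite (walk_end_inj W1' W1) in W2'.
  by rewrite (walk_end_inj W2 W2').
(* the distance from [v] grows along the vertices at multiples of [D + 1] *)
have grow j p1 p2 p3 y z : p = p1 ++ p2 ++ p3 -> walk v p1 y -> walk y p2 z ->
    size p1 = (j * D.+1)%N -> size p2 = D.+1 ->
    (dist v y < dist v z)%N /\ (D < dist v z)%N.
  elim: j p1 p2 p3 y z => [|j IH] p1 p2 p3 y z E W1 W2 s1 s2.
    move: s1; rewrite mul0n => /size0nil E1; subst p1; rewrite -[y]W1 in W2 *.
    by rewrite (geo [::] p2 p3 v z) ?s2 ?dist_refl //; lia.
  move: W1; rewrite -(cat_take_drop (j * D.+1) p1) => /walk_cat[x [W0 W1]].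
  set q0 := take _ p1 in W0; set q1 := drop _ p1 in W1.
  have z0 : size q0 = (j * D.+1)%N by rewrite size_take s1; case: ltnP => //; lia.
  have z1 : size q1 = D.+1 by rewrite size_drop s1; lia.
  have E' : p = q0 ++ q1 ++ (p2 ++ p3) by rewrite catA cat_take_drop.
  have [L1 L2] := IH _ _ _ _ _ E' W0 W1 z0 z1.
  have dx := walk_end_dim W0 dv; have dy := walk_end_dim W1 dx.
  have dz := walk_end_dim W2 dy.
  have Exz : dist x z = (2 * D.+1)%N.
    rewrite (geo q0 (q1 ++ p2) p3 x z) ?size_cat ?z1 ?s2 //; try lia.
      by rewrite E' -!catA.
    by apply/walk_cat; exists y.
  have Exy : dist x y = D.+1 by rewrite (geo q0 q1 (p2 ++ p3)) // z1; lia.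
  have Eyz : dist y z = D.+1.
    rewrite -s2; apply: (geo (q0 ++ q1) p2 p3) => //; last by lia.
      by rewrite E' -catA.
    by apply/walk_cat; exists x.
  have := H v x y z dv dx dy dz; rewrite Exz Exy Eyz; lia.
have q0 : (0 < size p %/ D.+1)%N by rewrite divn_gt0.
pose j := (size p %/ D.+1).-1.
pose p1 := take (j * D.+1) p; pose p2 := take D.+1 (drop (j * D.+1) p).
pose p3 := drop D.+1 (drop (j * D.+1) p).
have E : p = p1 ++ p2 ++ p3 by rewrite /p2 /p3 !cat_take_drop.
have Ep := divn_eq (size p) D.+1; have r := ltn_pmod (size p) (ltn0Sn D).
have Ej : (size p %/ D.+1)%N = j.+1 by rewrite /j prednK.
rewrite Ej in Ep.
have s1 : size p1 = (j * D.+1)%N by rewrite size_take; case: ltnP => //; lia.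
have s2 : size p2 = D.+1 by rewrite size_take size_drop; case: ltnP => //; lia.
have s3 : (size p3 < D.+1)%N by rewrite !size_drop; lia.
move: W; rewrite {1}E => /walk_cat[y [W1 /walk_cat[z [W2 W3]]]].
have [_ L] := grow _ _ _ _ _ _ E W1 W2 s1 s2.
have dz := walk_end_dim W2 (walk_end_dim W1 dv).
have := dist_le dz W3; rewrite dist_sym //; lia.
Qed.

(** Replacing a short subwalk by a shorter one with the same ends cuts off one
    closed walk of bounded length and leaves a shorter closed walk. *)
Lemma four_point_fills_short D v p : four_point D -> dim v = 0%N -> walk v p v ->
  fills (fun q => (exists2 x, dim x = 0%N & walk x q x) /\ (size q <= 4 * D.+1)%N)
    (size p) p.
Proof.
move=> H dv; have [k] := ubnP (size p); elim: k => // k IH in p *.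
rewrite ltnS => pk W; have [small|big] := leqP (size p) (4 * D.+1).
  case: (posnP (size p)) => [/size0nil ->|s0].
    by apply: fills0 => e; rewrite wchain_nil.
  apply: (@fills_le _ _ _ 1) => //; apply: fills1; split=> //.
  by exists v.
have [|p1 [p2 [p3 [x [y [E [W1 W2 W3] s2 L]]]]]] := closed_walk_shortcut H dv W.
  by lia.
have dx := walk_end_dim W1 dv; have dy := walk_end_dim W2 dx.
have [q Wq sq] := dist_walk dx dy.
have Ep : size p = (size p1 + (size p2 + size p3))%N by rewrite E !size_cat.
apply: (@fills_le _ _ _ (1 + size (p1 ++ q ++ p3))).
  by rewrite !size_cat; lia.
apply: (@fills_add _ _ _ _ _ _ (p2 ++ rwalk q) (p1 ++ q ++ p3)).
- by move=> e; rewrite E !wchain_cat wchain_rwalk ?(walk_darts Wq) //; ring.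
- apply: fills1; split; last by rewrite size_cat size_rwalk; lia.
  by exists x => //; apply/walk_cat; exists y; split=> //; apply: walk_rwalk.
- apply: IH; first by rewrite !size_cat; lia.
  by apply/walk_cat; exists x; split=> //; apply/walk_cat; exists y.
Qed.

Lemma four_point_fills_circuits D v p :
  four_point D -> dim v = 0%N -> walk v p v ->
  fills (fun q => circuit q /\ (size q <= 4 * D.+1)%N) (size p * (4 * D.+1)) p.
Proof.
move=> H dv W; apply: fills_trans (four_point_fills_short H dv W).
move=> q [[x dx Wq] sq]; apply: (fills_le sq).
exact: (closed_walk_fills_circuits Wq sq).
Qed.

End Circuits.

(** * Hyperbolicity of the metric graph and of its vertices *)

Section Points.
Variables (R : realType) (X : complex R).
Hypothesis conX : connected_complex X.
Implicit Types (v w : cell X) (x y z : cell X * R) (l : R).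

Local Notation lengths x y :=
  ([set l | exists v w p l1 l2, [/\ to_vertex x v l1, to_vertex y w l2,
      walk v p w & l = l1 + (size p)%:R + l2]] `|`
   [set l | [/\ x.1 = y.1, dim x.1 = 1%N & l = `|x.2 - y.2|]]).

Lemma to_vertex_ge0 x v l : point x -> to_vertex x v l -> 0 <= l <= 1.
Proof.
move=> [_ /andP[x0 x1]] [[_ [_ ->]]|[_ [a _ ->]]]; first by rewrite lexx ler01.
by case: (pos a); apply/andP; split; lra.
Qed.

Lemma to_vertex_dim x v l : to_vertex x v l -> dim v = 0%N.
Proof.
move=> [[d [-> _]] //|[d [a [h <-] _]]].
by apply: low_dim0; rewrite h.
Qed.

Lemma point_vertex x : point x -> exists v l, to_vertex x v l.
Proof.
move=> [dx _]; case: (posnP (dim x.1)) => d0.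
  by exists x.1, 0; left.
have d1 : dim x.1 = 1%N by apply/eqP; rewrite eqn_leq dx d0.
have [a [_ [ha _ _ _ _]]] := edge_ends d1.
by exists (low a), (if pos a then 1 - x.2 else x.2); right; split=> //; exists a.
Qed.

Lemma to_vertex_close x y v w l l' : x.1 = y.1 ->
  to_vertex x v l -> to_vertex y w l' -> (dist v w <= 1)%N.
Proof.
move=> E [[d [-> _]]|[d [a [ha <-] _]]] [[d' [-> _]]|[d' [b [hb <-] _]]].
- by rewrite E dist_refl.
- by move: d'; rewrite -E d.
- by move: d'; rewrite -E d.
have [->|N] := eqVneq a b; first by rewrite dist_refl // low_dim0 // hb.
by apply: (@dist_step _ _ conX (a, b)); rewrite /dart /= ha hb -E d eqxx N eqxx.
Qed.

Lemma lengths_ge0 x y : point x -> point y -> lbound (lengths x y) 0.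
Proof.
move=> px py l /= [[v [w [p [l1 [l2 [t1 t2 _ ->]]]]]]|[_ _ ->]] //.
have /andP[? _] := to_vertex_ge0 px t1; have /andP[? _] := to_vertex_ge0 py t2.
by rewrite !addr_ge0.
Qed.

Lemma path_dist_le x y v w l1 l2 : point x -> point y ->
  to_vertex x v l1 -> to_vertex y w l2 ->
  path_dist x y <= l1 + (dist v w)%:R + l2.
Proof.
move=> px py t1 t2; apply: ge_inf; first by exists 0; apply: lengths_ge0.
left; have [p W <-] := dist_walk conX (to_vertex_dim t1) (to_vertex_dim t2).
by exists v, w, p, l1, l2.
Qed.

(** The infimum may be approached through other ends of the two edges, or
    inside a common edge; this moves [v] and [w] by at most 1 each. *)
Lemma path_dist_ge x y v w l1 l2 : point x -> point y ->
  to_vertex x v l1 -> to_vertex y w l2 ->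
  (dist v w)%:R <= path_dist x y + 2.
Proof.
move=> px py t1 t2; rewrite -lerBlDr; apply: lb_le_inf.
  have [p W _] := dist_walk conX (to_vertex_dim t1) (to_vertex_dim t2).
  by exists (l1 + (size p)%:R + l2); left; exists v, w, p, l1, l2.
have dv := to_vertex_dim t1; have dw := to_vertex_dim t2.
move=> l /= [[v' [w' [p [l1' [l2' [t1' t2' W ->]]]]]]|[E _ ->]]; last first.
  have : (dist v w)%:R <= 1 :> R by rewrite -[1]/(1%:R) ler_nat (to_vertex_close E t1 t2).
  by have := normr_ge0 (x.2 - y.2); lra.
have /andP[? _] := to_vertex_ge0 px t1'; have /andP[? _] := to_vertex_ge0 py t2'.
have dv' := to_vertex_dim t1'; have dw' := to_vertex_dim t2'.
have L1 := to_vertex_close erefl t1 t1'; have L2 := to_vertex_close erefl t2' t2.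
have L : (dist v w <= size p + 2)%N.
  have := dist_triangle conX dv dv' dw; have := dist_triangle conX dv' dw' dw.
  by have := dist_le conX dv' W; lia.
by move: L; rewrite -(ler_nat R) natrD; lra.
Qed.

Lemma point_of_vertex v : dim v = 0%N -> @point R X (v, 0).
Proof. by move=> dv; split; rewrite /= ?dv ?lexx ?ler01. Qed.

Lemma path_dist_vertex v w : dim v = 0%N -> dim w = 0%N ->
  path_dist (v, 0) (w, 0) = (dist v w)%:R :> R.
Proof.
move=> dv dw; have pv := point_of_vertex dv; have pw := point_of_vertex dw.
have tv : @to_vertex R X (v, 0) v 0 by left.
have tw : @to_vertex R X (w, 0) w 0 by left.
apply/eqP; rewrite eq_le; apply/andP; split.
  by have := path_dist_le pv pw tv tw; rewrite add0r addr0.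
apply: lb_le_inf.
  have [p W _] := dist_walk conX dv dw.
  by exists (0 + (size p)%:R + 0); left; exists v, w, p, 0, 0.
move=> l /= [[v' [w' [p [l1 [l2 [t1 t2 W ->]]]]]]|[_ d1 _]]; last by rewrite dv in d1.
case: t1 => [[_ [/= Ev ->]]|[/= d1 _]]; last by rewrite dv in d1.
case: t2 => [[_ [/= Ew ->]]|[/= d1 _]]; last by rewrite dw in d1.
by rewrite add0r addr0 ler_nat; subst; apply: dist_le.
Qed.

Lemma hyperbolic_four_point delta :
  gromov_hyperbolic X delta -> exists D, @four_point R X D.
Proof.
move=> H; have [D HD] : exists D : nat, 2 * delta <= D%:R.
  exists (Num.bound (2 * delta)); have [d0|d0] := leP 0 (2 * delta).
    exact/ltW/archi_boundP.
  by apply: le_trans (ltW d0) _.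
exists D => x y z w dx dy dz dw.
have := H (x, 0) (y, 0) (z, 0) (w, 0).
move/(_ (point_of_vertex dx) (point_of_vertex dy) (point_of_vertex dz)
        (point_of_vertex dw)).
rewrite /gromov_product !path_dist_vertex //.
rewrite -(ler_nat R) !natrD.
have := leq_maxl (dist x y + dist z w) (dist x w + dist y z).
have := leq_maxr (dist x y + dist z w) (dist x w + dist y z).
rewrite -!(ler_nat R) !natrD /Num.min.
by case: ifP => _; lra.
Qed.

(** Each distance of points is within 2 of a distance of vertices, and a Gromov
    product is half a signed sum of three distances. *)
Lemma four_point_hyperbolic D : @four_point R X D ->
  exists2 delta : R, 0 <= delta & gromov_hyperbolic X delta.
Proof.
move=> H; exists (D%:R + 6); first by rewrite addr_ge0.
move=> x y z w px py pz pw.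
have [vx [lx tx]] := point_vertex px; have [vy [ly ty]] := point_vertex py.
have [vz [lz tz]] := point_vertex pz; have [vw [lw tw]] := point_vertex pw.
have up (a b : cell X * R) va vb la lb : point a -> point b -> to_vertex a va la ->
    to_vertex b vb lb -> path_dist a b <= (dist va vb)%:R + 2.
  move=> pa pb ta tb; have := path_dist_le pa pb ta tb.
  have /andP[_ ?] := to_vertex_ge0 pa ta; have /andP[_ ?] := to_vertex_ge0 pb tb.
  by lra.
have := H vx vy vz vw (to_vertex_dim tx) (to_vertex_dim ty) (to_vertex_dim tz)
  (to_vertex_dim tw).
have := up _ _ _ _ _ _ px pw tx tw; have := path_dist_ge px pw tx tw.
have := up _ _ _ _ _ _ py pw ty tw; have := path_dist_ge py pw ty tw.
have := up _ _ _ _ _ _ pz pw tz tw; have := path_dist_ge pz pw tz tw.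
have := up _ _ _ _ _ _ px py tx ty; have := path_dist_ge px py tx ty.
have := up _ _ _ _ _ _ py pz ty tz; have := path_dist_ge py pz ty tz.
have := up _ _ _ _ _ _ px pz tx tz; have := path_dist_ge px pz tx tz.
rewrite /gromov_product; move: (path_dist _ _) (path_dist _ _) (path_dist _ _).
move=> ? ? ?; move: (path_dist _ _) (path_dist _ _) (path_dist _ _) => ? ? ?.
move=> ? ? ? ? ? ? ? ? ? ? ? ?; have D0 : 0 <= D%:R :> R by [].
case: (leqP (dist vx vy + dist vz vw) (dist vx vw + dist vy vz)) => _;
  rewrite -(ler_nat R) !natrD /Num.min => ?; by case: ltP; lra.
Qed.

End Points.

(** * Slim triangles in integer-valued geodesic spaces *)

Section Slim.
Variables (V : Type) (d : V -> V -> nat).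
Hypothesis d_refl : forall x, d x x = 0%N.
Hypothesis d_sym : forall x y, d x y = d y x.
Hypothesis d_tri : forall x y z, (d x z <= d x y + d y z)%N.

Definition geod n (g : nat -> V) : Prop :=
  forall i j, (i <= j)%N -> (j <= n)%N -> d (g i) (g j) = (j - i)%N.

Hypothesis d_geod : forall x y,
  exists g, [/\ geod (d x y) g, g 0%N = x & g (d x y) = y].

(** Paths outside the open ball of radius [D] around [p].  Trivial steps are
    allowed and [n] is only an upper bound for the length, so that paths
    concatenate and reverse freely. *)
Definition far p D n x y : Prop := exists s : seq V,
  [/\ path (fun u v => (d u v <= 1)%N) x s, last x s = y, (size s <= n)%N &
      all (fun z => (D <= d p z)%N) (x :: s)].

Lemma far_refl p D n x : (D <= d p x)%N -> far p D n x x.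
Proof. by move=> H; exists [::]; rewrite /= H. Qed.

Lemma far_cat p D n m x y z : far p D n x y -> far p D m y z -> far p D (n + m) x z.
Proof.
move=> [s [P1 L1 S1 A1]] [t [P2 L2 S2 A2]]; exists (s ++ t); split.
- by rewrite cat_path P1 L1.
- by rewrite last_cat L1.
- by rewrite size_cat leq_add.
- by rewrite -cat_cons all_cat A1; case/andP: A2.
Qed.

Lemma far_step p D x y : (d x y <= 1)%N -> (D <= d p x)%N -> (D <= d p y)%N ->
  far p D 1 x y.
Proof. by move=> H1 H2 H3; exists [:: y]; rewrite /= H1 H2 H3. Qed.

Lemma far_le p D n m x y : (n <= m)%N -> far p D n x y -> far p D m x y.
Proof. by move=> nm [s [P L S A]]; exists s; split=> //; apply: leq_trans nm. Qed.

Lemma far_sym p D n x y : far p D n x y -> far p D n y x.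
Proof.
move=> [s]; elim: s n x => [|u s IH] n x [/=].
  by move=> _ -> _ /andP[H _]; apply: far_refl.
move=> /andP[xu P] L S /and3P[Hx Hu A].
apply: (@far_le _ _ ((size s) + 1)); first by rewrite addn1.
apply: (@far_cat _ _ _ _ _ u); first by apply: IH; split=> //=; rewrite Hu.
by apply: far_step => //; rewrite d_sym.
Qed.

Lemma far_geod_up p D n g i k : geod n g -> (i + k <= n)%N ->
  (forall l, (i <= l <= i + k)%N -> (D <= d p (g l))%N) ->
  far p D k (g i) (g (i + k)%N).
Proof.
move=> gg; elim: k => [|k IH] ik H.
  by rewrite addn0; apply/far_refl/H; lia.
rewrite -[k.+1]addn1; apply: (@far_cat _ _ _ _ _ (g (i + k)%N)).
  by apply: IH => [|l l1]; [|apply: H]; lia.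
by apply: far_step; [rewrite gg|apply: H|apply: H]; lia.
Qed.

Lemma far_geod p D n g i j : geod n g -> (i <= n)%N -> (j <= n)%N ->
  (forall l, (minn i j <= l <= maxn i j)%N -> (D <= d p (g l))%N) ->
  far p D (d (g i) (g j)) (g i) (g j).
Proof.
move=> gg; wlog ij : i j / (i <= j)%N => [W|].
  move=> ni nj H; have [/W|/ltnW/W] := leqP i j; first by apply.
  move=> K; rewrite d_sym; apply/far_sym/K => // l.
  by rewrite minnC maxnC; apply: H.
move=> ni nj H; rewrite gg // -{2}(subnKC ij); apply: (far_geod_up gg); first by lia.
by move=> l Hl; apply: H; lia.
Qed.

Lemma geod_sub n g i : geod n g -> (i <= n)%N -> geod (n - i) (fun k => g (i + k)%N).
Proof. by move=> gg ni a b ab bn; rewrite gg; lia. Qed.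

Lemma geod_rev n m g : geod n g -> (m <= n)%N -> geod m (fun k => g (n - k)%N).
Proof. by move=> gg mn a b ab bn; rewrite d_sym gg; lia. Qed.

(** Half of the distance to [p] is more than the whole length of a geodesic
    from [u] to [x]. *)
Lemma far_near p D u x : (2 * D <= d p u)%N -> (d u x <= D)%N -> far p D D u x.
Proof.
move=> Hu Hx; have [g [gg g0 g1]] := d_geod u x.
apply: (far_le Hx); rewrite -[X in far _ _ _ _ X]g1 -[X in far _ _ _ X]g0.
apply: (far_geod_up gg) => // l Hl.
have e : d u (g l) = l by rewrite -{1}g0 gg ?subn0 //; lia.
by have := d_tri p (g l) u; rewrite (d_sym (g l)) e; lia.
Qed.

Definition near D n g x : Prop := exists2 i, (i <= n)%N & (d x (g i) <= D)%N.

Definition triangle na nb nc (a b c : nat -> V) : Prop :=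
  [/\ geod na a, geod nb b & geod nc c] /\
  [/\ a 0%N = b 0%N, a na = c 0%N & b nb = c nc].

(** Slimness of the triangles of perimeter at most [n], for which some constant
    [D] works trivially. *)
Definition slim_upto n D : Prop := forall na nb nc a b c,
  triangle na nb nc a b c -> (na + nb + nc <= n)%N ->
  forall k, (k <= na)%N -> near D nb b (a k) \/ near D nc c (a k).

(** Two sides with a common end [c] that avoid the ball around [p] can be
    joined outside it: follow one side for a length [8 D], by which time
    slimness forces it to be close to the other one, and jump. *)
Lemma slim_cross n D p nb nc b c i j :
  slim_upto n D -> (0 < D)%N -> geod nb b -> geod nc c -> b nb = c nc ->
  (forall l, (l <= nb)%N -> (D <= d p (b l))%N) ->
  (forall l, (l <= nc)%N -> (D <= d p (c l))%N) ->
  (i <= nb)%N -> (j <= nc)%N -> ((nb - i) + d (b i) (c j) + (nc - j) <= n)%N ->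
  (d (b i) (c j) <= 6 * D)%N -> (d p (b i) <= 3 * D)%N ->
  far p D (24 * D) (b i) (c j).
Proof.
move=> sl D0 gb gc bc Hb Hc ib jc per dxy dpx.
have farb k : (k <= nb)%N -> far p D (d (b i) (b k)) (b i) (b k).
  by move=> kb; apply: (far_geod gb) => // l Hl; apply: Hb; lia.
have farc k : (k <= nc)%N -> far p D (d (c k) (c j)) (c k) (c j).
  by move=> kc; apply: (far_geod gc) => // l Hl; apply: Hc; lia.
have [short|long] := leqP (nb - i) (8 * D).
  have Eb : d (b i) (b nb) = (nb - i)%N by rewrite gb.
  have Ec : d (c nc) (b i) = (nb - i)%N by rewrite -bc d_sym.
  have := d_tri (c nc) (b i) (c j); rewrite Ec => tr.
  apply: (@far_le _ _ (d (b i) (b nb) + d (c nc) (c j))); first by lia.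
  by apply: (@far_cat _ _ _ _ _ (b nb)); [apply: farb|rewrite bc; apply: farc].
have [g [gg g0 g1]] := d_geod (b i) (c j).
have tri : triangle (nb - i) (d (b i) (c j)) (nc - j)
    (fun k => b (i + k)%N) g (fun k => c (nc - k)%N).
  split; split=> //.
  - exact: geod_sub.
  - by apply: geod_rev => //; lia.
  - by rewrite addn0 g0.
  - by rewrite subnKC // bc subn0.
  - by rewrite g1 subKn.
have Ez : d (b i) (b (i + 8 * D)%N) = (8 * D)%N by rewrite gb; lia.
have [] := sl _ _ _ _ _ _ tri per (8 * D)%N; first exact: ltnW.
  move=> [l Hl Hd]; have := d_tri (b i) (g l) (b (i + 8 * D)%N).
  by rewrite -{2}g0 gg // (d_sym (g l)) Ez; lia.
move=> [l Hl Hd]; set z := b (i + 8 * D)%N in Hd Ez; set z' := c (nc - l)%N in Hd.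
have tr : (d z' (c j) <= 15 * D)%N.
  have := d_tri z' z (c j); have := d_tri z (b i) (c j).
  by rewrite (d_sym z' z) (d_sym z (b i)); lia.
have dpz : (5 * D <= d p z)%N by have := d_tri (b i) p z; rewrite (d_sym (b i) p); lia.
apply: (@far_le _ _ (8 * D + D + 15 * D)); first by lia.
apply: (@far_cat _ _ _ _ _ z'); last by apply/(far_le tr)/farc; lia.
apply: (@far_cat _ _ _ _ _ z); first by rewrite -Ez; apply: farb; lia.
by apply: far_near => //; lia.
Qed.

(** The only input on the space: a path that goes around a point [p] of a
    geodesic at distance [D] has length at least quadratic in [D]. *)
Variable M : nat.
Hypothesis avoid_long : forall a b p D n, (d a p + d p b = d a b)%N ->
  far p D n b a -> (D * D.-1 <= M * (d a b + n))%N.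

(** Suppose that the vertex [p] of the side [a] is at distance [D] from the
    other two sides, where [D] is the slimness constant.  The points of [a] at
    distance [2 D] on both sides of [p] (or the ends of [a], if these are nearer)
    are within [D] of points [x] and [y] of the other sides, hence
    [d x y <= 6 D].  Joining [x] to [y] outside the ball around [p] closes up the
    part of [a] around [p] by a path of length linear in [D], so that the
    quadratic lower bound [avoid_long] bounds [D]. *)
Lemma slim_step n D na nb nc a b c k : slim_upto n D -> (0 < D)%N ->
  triangle na nb nc a b c -> (na + nb + nc <= n)%N -> (k <= na)%N ->
  (forall l, (l <= nb)%N -> (D <= d (a k) (b l))%N) ->
  (forall l, (l <= nc)%N -> (D <= d (a k) (c l))%N) ->
  (D <= 30 * M + 1)%N.
Proof.
move=> sl D0 tri per ka Hb Hc; set p := a k in Hb Hc.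
have [[ga gb gc] [ab ac bc]] := tri.
pose side x := (exists2 i, (i <= nb)%N & x = b i) \/ (exists2 j, (j <= nc)%N & x = c j).
have side_far x : side x -> (D <= d p x)%N.
  by move=> [[i ib ->]|[j jc ->]]; [apply: Hb|apply: Hc].
have exit i : (i <= na)%N -> (2 * D <= d p (a i))%N \/ side (a i) ->
    exists x, [/\ side x, far p D D (a i) x & (d (a i) x <= D)%N].
  move=> ia [Hi|sx]; last first.
    by exists (a i); split; rewrite ?d_refl //; apply/far_refl/side_far.
  have [[l lb Hd]|[l lc Hd]] := sl _ _ _ _ _ _ tri per i ia.
    by exists (b l); split; [left; exists l| exact: far_near|].
  by exists (c l); split; [right; exists l| exact: far_near|].
have cross x y : side x -> side y -> (d p x <= 3 * D)%N -> (d p y <= 3 * D)%N ->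
    (d x y <= 6 * D)%N -> far p D (24 * D) x y.
  have perij i j : (i <= nb)%N -> (j <= nc)%N ->
      (nb - i + d (b i) (c j) + (nc - j) <= n)%N.
    move=> ib jc; have := d_tri (b i) (b 0%N) (c j); have := d_tri (b 0%N) (c 0%N) (c j).
    have e1 : d (b 0%N) (c 0%N) = na by rewrite -ab -ac ga // subn0.
    have e2 : d (c 0%N) (c j) = j by rewrite gc // subn0.
    have e3 : d (b i) (b 0%N) = i by rewrite d_sym gb // subn0.
    by rewrite e1 e2 e3; lia.
  move=> [[i ib ->]|[i ic ->]] [[j jb ->]|[j jc ->]] dx dy dxy.
  - apply: (@far_le _ _ (d (b i) (b j))); first by lia.
    by apply: (far_geod gb) => // l Hl; apply: Hb; lia.
  - by apply: (slim_cross sl D0 gb gc bc) => //; exact: perij.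
  - rewrite d_sym in dxy; apply: far_sym.
    by apply: (slim_cross sl D0 gb gc bc) => //; exact: perij.
  - apply: (@far_le _ _ (d (c i) (c j))); first by lia.
    by apply: (far_geod gc) => // l Hl; apply: Hc; lia.
pose i1 := (k - 2 * D)%N; pose i2 := minn (k + 2 * D) na.
have E1 : d p (a i1) = (k - i1)%N by rewrite d_sym ga //; lia.
have E2 : d p (a i2) = (i2 - k)%N by rewrite ga //; lia.
have [||x [sx fx dx]] := exit i1; first by lia.
  have [H|H] := leqP (2 * D) k; first by left; rewrite E1; lia.
  by right; left; exists 0%N => //; rewrite (_ : i1 = 0)%N //; lia.
have [||y [sy fy dy]] := exit i2; first by lia.
  have [H|H] := leqP (k + 2 * D) na; first by left; rewrite E2; lia.
  by right; right; exists 0%N => //; rewrite (_ : i2 = na)%N //; lia.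
have dpx : (d p x <= 3 * D)%N by have := d_tri p (a i1) x; lia.
have dpy : (d p y <= 3 * D)%N by have := d_tri p (a i2) y; lia.
have dxy : (d x y <= 6 * D)%N by have := d_tri x p y; rewrite (d_sym x p); lia.
have fl : far p D (D + (24 * D + D)) (a i2) (a i1).
  apply: far_sym; apply: (far_cat fx); apply: (@far_cat _ _ _ _ _ y).
    exact: cross.
  exact: far_sym.
have /avoid_long/(_ fl) : (d (a i1) p + d p (a i2) = d (a i1) (a i2))%N.
  by rewrite (d_sym (a i1)) E1 E2 ga; lia.
rewrite ga; [|lia|lia] => K.
have : (D * D.-1 <= D * (30 * M))%N.
  apply: leq_trans K _; rewrite mulnA [(D * 30)%N]mulnC -mulnA [(D * M)%N]mulnC mulnCA.
  by rewrite leq_mul2l; apply/orP; right; lia.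
by rewrite leq_pmul2l //; lia.
Qed.

(** The least constant for which all triangles up to a given perimeter are
    slim is attained by some triangle, which bounds it by [slim_step]. *)
Lemma slim_triangles n : slim_upto n (30 * M + 1).
Proof.
have mono D D' : (D <= D')%N -> slim_upto n D -> slim_upto n D'.
  move=> DD sl na nb nc a b c tri per k ka.
  by have [[l Hl Hd]|[l Hl Hd]] := sl _ _ _ _ _ _ tri per k ka;
    [left|right]; exists l => //; apply: leq_trans DD.
have [|D /asboolP sl minD] := @ex_minnP (fun D => `[< slim_upto n D >]).
  exists n; apply/asboolP => na nb nc a b c [[ga _ _] [ab _ _]] per k ka.
  by left; exists 0%N => //; rewrite -ab d_sym ga //; lia.
have [small|big] := leqP D (30 * M + 1); first exact: mono sl.
have := minD D.-1; rewrite (_ : (D <= D.-1)%N = false); last by lia.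
move=> /contraFN /(_ erefl) /asboolPn ns; exfalso; apply: ns.
move=> na nb nc a b c tri per k ka; apply: contrapT => /not_orP[Nb Nc].
have : (D <= 30 * M + 1)%N; last by lia.
apply: (slim_step sl _ tri per ka); first by lia.
- move=> l Hl; rewrite leqNgt; apply/negP => lt; apply: Nb; exists l => //; lia.
- move=> l Hl; rewrite leqNgt; apply/negP => lt; apply: Nc; exists l => //; lia.
Qed.

(** In a slim triangle some point of the side [x y] is close to the other two
    sides, so its distance to [w] is about the Gromov product of [x] and
    [y]. *)
Lemma gromov_product_attained D x y w : (forall n, slim_upto n D) ->
  exists g k, [/\ geod (d x y) g /\ (g 0%N = x /\ g (d x y) = y), (k <= d x y)%N &
    (2 * d w (g k) + d x y <= d w x + d w y + 4 * D + 2)%N].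
Proof.
move=> sl; have [a [ga a0 a1]] := d_geod x y; have [b [gb b0 b1]] := d_geod x w.
have [c [gc c0 c1]] := d_geod y w.
have tri : triangle (d x y) (d x w) (d y w) a b c.
  by split; split; rewrite ?a0 ?a1 ?b1 ?c1.
suff [k [ka [i ib Hi] [j jc Hj]]] :
    exists k, [/\ (k <= d x y)%N, near D (d x w) b (a k) & near D.+1 (d y w) c (a k)].
  exists a, k; split=> //.
  have e1 : d x (a k) = k by rewrite -{1}a0 ga // subn0.
  have e2 : d (a k) y = (d x y - k)%N by rewrite -{1}a1 ga.
  have e3 : d x (b i) = i by rewrite -{1}b0 gb // subn0.
  have e4 : d (b i) w = (d x w - i)%N by rewrite -{1}b1 gb.
  have e5 : d y (c j) = j by rewrite -{1}c0 gc // subn0.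
  have e6 : d (c j) w = (d y w - j)%N by rewrite -{1}c1 gc.
  have := d_tri x (b i) (a k); have := d_tri (a k) (b i) w.
  have := d_tri (a k) (c j) w; have := d_tri y (c j) (a k).
  rewrite (d_sym (b i) (a k)) (d_sym (c j) (a k)) (d_sym w) (d_sym w x) (d_sym w y).
  by rewrite (d_sym y (a k)); lia.
pose Q k := (k <= d x y)%N && `[< near D (d x w) b (a k) >].
have [||k /andP[ka /asboolP nb] maxk] := @ex_maxnP Q (d x y).
- by exists 0%N; apply/andP; split=> //; apply/asboolP; exists 0%N; rewrite // a0 b0 d_refl.
- by move=> k /andP[].
exists k; split=> //.
have [e|lt] := eqVneq k (d x y); first by exists 0%N; rewrite // e a1 c0 d_refl.
have k1 : (k.+1 <= d x y)%N by rewrite ltn_neqAle lt.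
have [nb'|[j jc Hj]] := sl _ _ _ _ _ _ _ tri (leqnn _) k.+1 k1.
  have := maxk k.+1; rewrite /Q k1 ltnn /= => /contraFN/(_ erefl)/asboolPn.
  by case.
exists j => //; have := d_tri (a k) (a k.+1) (c j); rewrite ga //; lia.
Qed.

(** The Gromov product of [x] and [z] based at [w] is about the distance from
    [w] to a point of a geodesic from [x] to [z]; by slimness this point is close
    to one of the geodesics from [x] to [y] and from [z] to [y], and the
    distance to a geodesic always bounds the Gromov product from above. *)
Lemma slim_four_point D x y z w : (forall n, slim_upto n D) ->
  (d x z + d y w <= maxn (d x y + d z w) (d x w + d y z) + (6 * D + 2))%N.
Proof.
move=> sl; have [a [k [[ga [a0 a1]] ka Hk]]] := gromov_product_attained x z w sl.
have [b [gb b0 b1]] := d_geod x y; have [c [gc c0 c1]] := d_geod z y.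
have tri : triangle (d x z) (d x y) (d z y) a b c.
  by split; split; rewrite ?a0 ?a1 ?b1 ?c1.
have [[i ib Hi]|[j jc Hj]] := sl _ _ _ _ _ _ _ tri (leqnn _) k ka.
- have e3 : d x (b i) = i by rewrite -{1}b0 gb // subn0.
  have e4 : d (b i) y = (d x y - i)%N by rewrite -{1}b1 gb.
  have := d_tri w (a k) (b i); have := d_tri w (b i) x; have := d_tri w (b i) y.
  by rewrite (d_sym (b i) x) (d_sym w x) (d_sym w y) (d_sym w z) in Hk *; lia.
- have e3 : d z (c j) = j by rewrite -{1}c0 gc // subn0.
  have e4 : d (c j) y = (d z y - j)%N by rewrite -{1}c1 gc.
  have := d_tri w (a k) (c j); have := d_tri w (c j) z; have := d_tri w (c j) y.
  rewrite (d_sym (c j) z) (d_sym w x) (d_sym w y) (d_sym w z) (d_sym y z) in Hk *.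
  by lia.
Qed.

End Slim.

(** * From linear fillings to the four-point condition *)

Section FillingToFourPoint.
Variables (R : realType) (X : complex R).
Hypothesis conX : connected_complex X.
Local Notation dartT := (inc X * inc X)%type.
Implicit Types (v w x y z : cell X) (e : dartT) (p q s : seq dartT).

(** A cochain may be prescribed on darts, as long as reversal changes the
    sign. *)
Lemma antisymmetric_cochain (F : dartT -> int) :
  (forall e, dart e -> F (rdart e) = - F e) ->
  exists phi : cell X -> int, forall e, dart e -> sgn e * phi (dedge e) = F e.
Proof.
move=> aF; exists (fun c => xget 0
  [set k | exists e, [/\ dart e, dedge e = c & k = sgn e * F e]]) => e De.
have sgn2 e' : sgn e' * sgn e' = 1 by rewrite /sgn; case: ifP.
case: xgetP => [k -> [e' [De' E ->]]|/(_ (sgn e * F e))]; last first.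
  by case; exists e.
have [->|->] := dart_same_edge De De' (esym E); first by rewrite mulrA sgn2 mul1r.
by rewrite aF // sgn_rdart // mulrNN mulrA sgn2 mul1r.
Qed.

Lemma walk_dist_mem x p y e : dim x = 0%N -> walk x p y -> e \in p ->
  (dist x (dsrc e) <= size p)%N /\ (dist x (dtgt e) <= size p)%N.
Proof.
move=> dx W ep; move: W; case/splitPr: ep => p1 p2 W.
have [z [W1 [De Ez W2]]] := (walk_cat _ _ _ _).1 W.
rewrite size_cat /=; split.
  by rewrite Ez; apply: leq_trans (dist_le conX dx W1) _; lia.
apply: (@leq_trans (size (p1 ++ [:: e]))); last by rewrite size_cat /=; lia.
by apply: dist_le => //; apply/walk_cat; exists z.
Qed.

Section Cochain.
Variables (a c : cell X) (D : nat).
Hypotheses (da : dim a = 0%N) (dc : dim c = 0%N).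

Let h v : int := (D - dist c v)%N.
Let g v : int := dist a v.

(** The cochain [h dg]: it measures the progress away from [a], weighted by a
    bump function around [c].  The value of [h] is taken at the tail of the
    1-cell, so that the cochain is antisymmetric. *)
Let dtail e := if pos e.2 then dsrc e else dtgt e.
Definition bump e : int := h (dtail e) * (g (dtgt e) - g (dsrc e)).

Lemma bump_rdart e : dart e -> bump (rdart e) = - bump e.
Proof.
move=> De; rewrite /bump /dtail /= (dart_pos De).
by rewrite /dsrc /dtgt /=; case: (pos e.2) => /=; ring.
Qed.

Lemma dtail_dim e : dart e -> dim (dtail e) = 0%N.
Proof. by move=> De; rewrite /dtail; case: ifP; rewrite ?dsrc_dim ?dtgt_dim. Qed.

Lemma h_lip v w : dim v = 0%N -> dim w = 0%N -> `|h v - h w| <= dist v w.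
Proof.
move=> dv dw; have := dist_triangle conX dc dv dw; have := dist_triangle conX dc dw dv.
by rewrite /h (dist_sym conX dw dv); lia.
Qed.

Lemma g_lip e : dart e -> `|g (dtgt e) - g (dsrc e)| <= 1.
Proof.
move=> De; have ds := dsrc_dim De; have dt := dtgt_dim De.
have := dist_triangle conX da ds dt; have := dist_triangle conX da dt ds.
by have := dist_step conX De; rewrite /g (dist_sym conX dt ds); lia.
Qed.

Lemma sum_bump_shift x q y k : walk x q y ->
  \sum_(e <- q) bump e =
  \sum_(e <- q) (h (dtail e) - k) * (g (dtgt e) - g (dsrc e)) + k * (g y - g x).
Proof.
elim: q x => [|e q IH] x /=; first by move=> ->; rewrite !big_nil; ring.
by move=> [De <- /IH W]; rewrite !big_cons W /bump; ring.
Qed.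

(** Short closed walks see [h] as nearly constant, and [dg] integrates to
    zero along them. *)
Lemma sum_bump_closed x q l : dim x = 0%N -> walk x q x -> (size q <= l)%N ->
  \sum_(e <- q) bump e <= (l * l)%N.
Proof.
move=> dx W ql; rewrite (sum_bump_shift (h x) W) subrr mulr0 addr0.
apply: (@le_trans _ _ (\sum_(e <- q) (l%:Z))).
  rewrite big_seq [X in _ <= X]big_seq; apply: ler_sum => e eq.
  have De : dart e by move/allP: (walk_darts W); apply.
  have := h_lip (dtail_dim De) dx; have := g_lip De.
  have [L1 L2] := walk_dist_mem dx W eq.
  have : (dist (dtail e) x <= l)%N.
    apply: leq_trans ql; rewrite (dist_sym conX (dtail_dim De) dx).
    by rewrite /dtail; case: ifP.
  by move: (h _ - h _) (g _ - g _) => A B; nia.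
rewrite big_const_seq count_predT iter_addr addr0 -mulr_natr natz -PoszM lez_nat.
by rewrite leq_mul2l ql orbT.
Qed.

Lemma geodesic_steps x q y : walk x q y -> dim x = 0%N ->
  (dist a y = dist a x + size q)%N ->
  forall e, e \in q -> g (dtgt e) - g (dsrc e) = 1.
Proof.
elim: q x => [|e q IH] x //= [De Ex W] dx E; have dt := dtgt_dim De.
have dy := walk_end_dim W dt.
have L1 := g_lip De; have L2 := dist_le conX dt W; have L3 := dist_triangle conX da dt dy.
have Et : dist a (dtgt e) = (dist a x + 1)%N.
  by move: L1; rewrite /g Ex; lia.
move=> e'; rewrite inE => /orP[/eqP ->|]; first by rewrite /g Ex Et; lia.
by apply: (IH (dtgt e)) => //; rewrite Et; lia.
Qed.

(** Along a geodesic from [a] the cochain integrates [h]. *)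
Lemma sum_bump_geodesic_ge0 x q y : walk x q y -> dim x = 0%N ->
  (dist a y = dist a x + size q)%N -> 0 <= \sum_(e <- q) bump e.
Proof.
move=> W dx E; rewrite big_seq; apply: sumr_ge0 => e eq.
by rewrite /bump (geodesic_steps W dx E eq) mulr1.
Qed.

(** Near the centre [c] the bump function is large: the [i]-th dart before [c]
    contributes at least [D - i]. *)
Lemma sum_bump_geodesic x q : walk x q c -> dim x = 0%N -> size q = dist x c ->
  (dist a c = dist a x + size q)%N ->
  (\sum_(i < size q) (D - i.+1))%N%:Z <= \sum_(e <- q) bump e.
Proof.
elim: q x => [|e q IH] x W dx sq E; first by rewrite /= big_ord0 big_nil.
have st := geodesic_steps W dx E (mem_head _ _).
case: W => De Ex W; have dt := dtgt_dim De.
have L1 := dist_le conX dt W; have L2 := dist_triangle conX dx dt dc.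
have L3 := dist_step conX De; rewrite Ex in L3 st.
have Et : size q = dist (dtgt e) c by move: sq; rewrite /=; lia.
have Ea : (dist a c = dist a (dtgt e) + size q)%N by move: st E; rewrite /g /=; lia.
rewrite big_ord_recr /= big_cons PoszD addrC.
apply: lerD; last exact: (IH _ W dt Et Ea).
rewrite /bump -Ex /= in st *; rewrite st mulr1 /h lez_nat leq_sub2l //.
rewrite (dist_sym conX dc (dtail_dim De)) /dtail; case: ifP => _.
  by rewrite Ex -sq.
by rewrite -Et.
Qed.

End Cochain.

Lemma sum_subS D m : (D <= m)%N ->
  (2 * \sum_(i < m) (D - i.+1) = D * D.-1)%N.
Proof.
elim: m D => [|m IH] [|D] // Dm.
- by rewrite big_ord0.
- by rewrite big1 ?muln0.
rewrite big_ord_recl mulnDr /= subSS subn0.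
under eq_bigr => i _ do rewrite subSS /bump /=.
by rewrite (IH D Dm); case: D {Dm} => [|D] //=; lia.
Qed.

Variables (l C : nat).
Hypothesis fillX : forall x p, dim x = 0%N -> walk x p x ->
  fills (fun q => (exists2 x, dim x = 0%N & walk x q x) /\ (size q <= l)%N)
    (C * size p) p.

Let V := {v : cell X | dim v == 0%N}.
Let d (v w : V) := dist (sval v) (sval w).

Let vdim (v : V) : dim (sval v) = 0%N.
Proof. exact/eqP/(svalP v). Qed.

Lemma far_walk c D n (x y : V) : far d c D n x y -> exists q,
  [/\ walk (sval x) q (sval y), (size q <= n)%N &
    forall e, e \in q -> (D <= dist (sval c) (dsrc e))%N /\
                         (D <= dist (sval c) (dtgt e))%N].
Proof.
move=> [s]; elim: s n x => [|u s IH] n x [/=].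
  by move=> _ -> _ _; exists [::].
move=> /andP[xu P] L S /and3P[Hx Hu A].
have [q [W sq Hq]] : exists q, [/\ walk (sval u) q (sval y), (size q <= size s)%N &
    forall e, e \in q -> (D <= dist (sval c) (dsrc e))%N /\
                         (D <= dist (sval c) (dtgt e))%N].
  by apply: IH; split=> //=; rewrite Hu.
have [[|e [|e' r]] Wr sr] := dist_walk conX (vdim x) (vdim u).
- by exists q; rewrite Wr; split=> //; lia.
- case: Wr => De Ee /= Et; exists (e :: q); split=> //=.
  + by split=> //; rewrite Et.
  + by lia.
  move=> e'; rewrite inE => /orP[/eqP ->|/Hq //].
  by rewrite Ee Et; split.
- by move: xu; rewrite /d -sr /=; lia.
Qed.

(** Close the geodesic from [a] to [b] by the avoiding path.  The cochain
    [h dg] vanishes on the latter and is of order [D ^ 2] on the former, but it is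
    at most [l ^ 2] on each of the closed walks, linear in number, that fill the
    loop. *)
Lemma far_is_long (a b c : V) D n : (d a c + d c b = d a b)%N ->
  far d c D n b a -> (D * D.-1 <= 2 * C * (l * l) * (d a b + n))%N.
Proof.
move=> E fl; have [z [Wz sz Hz]] := far_walk fl.
have Dac : (D <= d a c)%N.
  case: fl => s [_ <- _ /allP]; rewrite /d => A.
  rewrite dist_sym ?(vdim a) ?(vdim c) //.
  by apply: A; exact: mem_last.
have [[da db] dc] := (vdim a, vdim b, vdim c).
have [p W1 s1] := dist_walk conX da dc; have [q W2 s2] := dist_walk conX dc db.
have Wpqz : walk (sval a) (p ++ q ++ z) (sval a).
  by apply/walk_cat; exists (sval c); split=> //; apply/walk_cat; exists (sval b).
pose F := bump (sval a) (sval c) D.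
have [phi Hphi] := antisymmetric_cochain (@bump_rdart (sval a) (sval c) D).
have wF r : all (@dart _ X) r -> wval phi r = \sum_(e <- r) F e.
  by move=> /allP A; apply: eq_big_seq => e /A /Hphi.
have [s [ss Bs Hs]] := fillX da Wpqz.
have up : wval phi (p ++ q ++ z) <= ((C * (d a b + n)) * (l * l))%N.
  rewrite (wval_sum phi Hs).
  apply: (@le_trans _ _ (\sum_(r <- s) ((l * l)%N : int))).
    rewrite big_seq [X in _ <= X]big_seq; apply: ler_sum => r rs.
    have [[x dx Wx] sr] := Bs r rs.
    by rewrite wF ?(walk_darts Wx) // (sum_bump_closed D da dc dx Wx sr).
  rewrite big_const_seq count_predT iter_addr addr0 -mulr_natr natz -PoszM lez_nat.
  rewrite mulnC leq_mul2r; apply/orP; right; apply: leq_trans ss _.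
  by rewrite leq_mul2l !size_cat s1 s2; apply/orP; right; move: E; rewrite /d; lia.
move: up; rewrite wF ?(walk_darts Wpqz) // !big_cat /=.
have -> : \sum_(e <- z) F e = 0.
  rewrite big_seq big1 // => e ez; have [h1 h2] := Hz e ez.
  by rewrite /F /bump (_ : (D - _)%N = 0%N) ?mul0r //; case: ifP; lia.
have L2 : 0 <= \sum_(e <- q) F e.
  apply: (sum_bump_geodesic_ge0 D da dc W2 dc).
  by rewrite s2 -[LHS]/(d a b) -E.
have L1 : (\sum_(i < size p) (D - i.+1))%N%:Z <= \sum_(e <- p) F e.
  by apply: (sum_bump_geodesic D da dc W1) => //; rewrite dist_refl // s1.
have := @sum_subS D (size p); rewrite s1 => /(_ Dac).
move: L1 L2; rewrite s1; move: (\sum_(i < _) _)%N => S.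
by move: (\sum_(e <- p) _) (\sum_(e <- q) _) => A B; nia.
Qed.

(** The vertices of a shortest walk form an isometric sequence. *)
Lemma vertex_geodesic (u v : V) :
  exists g, [/\ geod d (d u v) g, g 0%N = u & g (d u v) = v].
Proof.
have [p W sp] := dist_walk conX (vdim u) (vdim v).
have : forall i, exists t : V,
    walk (sval u) (take i p) (sval t) /\ walk (sval t) (drop i p) (sval v).
  move=> i; move: (W); rewrite -{1}(cat_take_drop i p) => /walk_cat[t [T1 T2]].
  have /eqP dt := walk_end_dim T1 (vdim u).
  by exists (exist _ t dt).
move=> /choice[g Hg]; exists g; split.
- move=> i j ij jn.
  have [Wi1 Wi2] := Hg i; have [Wj1 Wj2] := Hg j.
  have L0 := dist_le conX (vdim u) Wi1; have L1 := dist_le conX (vdim (g j)) Wj2.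
  have L2 : (d (g i) (g j) <= j - i)%N.
    have : walk (sval u) (take i p ++ drop i (take j p)) (sval (g j)).
      by rewrite -{1}(take_takel p ij) cat_take_drop.
    move=> /walk_cat[t [T1 T2]]; rewrite -(walk_end_inj Wi1 T1) in T2.
    apply: leq_trans (dist_le conX (vdim (g i)) T2) _.
    by rewrite size_drop size_take; case: ltnP; lia.
  have := dist_triangle conX (vdim u) (vdim (g i)) (vdim v).
  have := dist_triangle conX (vdim (g i)) (vdim (g j)) (vdim v).
  move: L0 L1 L2 jn; rewrite size_drop size_take /d -sp.
  by case: ltnP => ?; lia.
- by apply: val_inj; have [] := Hg 0%N; rewrite take0.
- by apply: val_inj; have [_] := Hg (d u v); rewrite /d -sp drop_size.
Qed.

Lemma fills_four_point : exists D, @four_point R X D.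
Proof.
have slim := slim_triangles (fun x : V => dist_refl conX (vdim x))
  (fun x y : V => dist_sym conX (vdim x) (vdim y))
  (fun x y z : V => dist_triangle conX (vdim x) (vdim y) (vdim z))
  vertex_geodesic far_is_long.
eexists => x y z w /eqP dx /eqP dy /eqP dz /eqP dw.
exact: (slim_four_point (d := d) (fun x : V => dist_refl conX (vdim x))
  (fun x y : V => dist_sym conX (vdim x) (vdim y))
  (fun x y z : V => dist_triangle conX (vdim x) (vdim y) (vdim z))
  vertex_geodesic (exist _ x dx) (exist _ y dy) (exist _ z dz) (exist _ w dw) slim).
Qed.

End FillingToFourPoint.

(** * Cellular chains as lists of walks *)

Lemma fsum_seq (T : choiceType) (W : nmodType) (A : set T) (F : T -> W) (r : seq T) :
  uniq r -> (forall a, A a -> F a != 0 -> a \in r) ->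
  \sum_(a \in A) F a = \sum_(a <- r | a \in A) F a.
Proof.
move=> ur H; rewrite (@fsbigE _ _ _ _ A [seq a <- r | a \in A]) ?filter_uniq //.
- by rewrite big_filter_cond; apply: eq_bigl => a; rewrite andbb.
- by move=> a /=; rewrite mem_filter => /andP[/set_mem].
- move=> a Aa; rewrite mem_filter mem_set //= => ar; apply/eqP; apply: contraNT ar.
  exact: H.
Qed.

Section Homology.
Variables (R : realType) (X : complex R).
Local Notation dartT := (inc X * inc X)%type.
Implicit Types (c x e f : cell X) (a : inc X) (d : dartT) (p q : seq dartT)
  (mu gamma : cell X -> int) (E : seq (cell X)).

Definition incs c : seq (inc X) := fset_set [set a | high a = c].

Lemma mem_incs c a : (a \in incs c) = (high a == c).
Proof.
rewrite /incs in_fset_set; last exact: (finite_boundary (complexP X)).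
by apply/idP/eqP => [/set_mem|H] //; apply/mem_set.
Qed.

Lemma uniq_incs c : uniq (incs c).
Proof. exact: fset_uniq. Qed.

Definition sg a : int := if pos a then 1 else -1.

(** The incidence number of the cell [s] with its face [c]. *)
Definition coef s c : int :=
  \sum_(a <- incs s | (low a == c) && (dim (high a) == (dim c).+1)) sg a.

Lemma bd_seq mu E c : uniq E -> (forall s, mu s != 0 -> s \in E) ->
  bd mu c = \sum_(s <- E) mu s * coef s c.
Proof.
move=> uE HE; rewrite /bd (@fsum_seq _ _ _ _ (flatten (map incs E))).
- rewrite big_flatten big_map; apply: eq_bigr => s _.
  rewrite /coef mulr_sumr big_mkcond [RHS]big_mkcond /=.
  apply: eq_big_seq => a; rewrite mem_incs => /eqP Ha.
  have -> : (a \in [set a | low a = c /\ dim (high a) = (dim c).+1]) =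
            (low a == c) && (dim (high a) == (dim c).+1).
    by apply/idP/andP => [/set_mem[-> ->]|[/eqP ? /eqP ?]] //; apply/mem_set.
  by rewrite Ha /sg; case: ifP => // _; case: ifP; rewrite ?mulr1 ?mulrN1.
- elim: E uE {HE} => //= s E IH /andP[sE uE].
  rewrite cat_uniq uniq_incs IH // andbT; apply/hasPn => a /flattenP[_ /mapP[t tE ->]].
  by rewrite !mem_incs => /eqP ->; apply: contra sE => /eqP <-.
- move=> a _ Ha; apply/flattenP; exists (incs (high a)); last by rewrite mem_incs.
  by apply/map_f/HE; move: Ha; case: ifP; rewrite ?oppr_eq0.
Qed.

Lemma l1norm_seq mu E : uniq E -> (forall s, mu s != 0 -> s \in E) ->
  l1norm mu = (\sum_(s <- E) `|mu s|)%N.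
Proof.
move=> uE HE; rewrite /l1norm (@fsum_seq _ _ _ _ E) //.
  by apply: eq_bigl => s; rewrite in_setT.
by move=> s _ H; apply: HE; move: H; apply: contraNneq => ->.
Qed.

Lemma chain_support i mu : chain i mu ->
  exists E, [/\ uniq E, forall c, mu c != 0 -> c \in E &
                forall c, c \in E -> dim c = i].
Proof.
move=> [fin dimE]; exists (fset_set [set c | mu c != 0]); split.
- exact: fset_uniq.
- by move=> c H; rewrite in_fset_set //; apply/mem_set.
- by move=> c; rewrite in_fset_set // => /set_mem /dimE.
Qed.

Lemma coef_dim s c : dim s != (dim c).+1 -> coef s c = 0.
Proof.
move=> H; rewrite /coef big_seq_cond big1 // => a /andP[+ /andP[_ E]].
by rewrite mem_incs => /eqP Ha; move: E; rewrite Ha (negbTE H).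
Qed.

Lemma coef_edge d x : dart d -> dim x = 0%N ->
  sgn d * coef (dedge d) x = (dtgt d == x)%:Z - (dsrc d == x)%:Z.
Proof.
move=> D dx; have [d1 h12 /eqP n12] := dartP D; have P := dart_pos D.
have pe : perm_eq (incs (dedge d)) [:: d.1; d.2].
  apply: uniq_perm; rewrite ?uniq_incs //= ?inE ?n12 // => a.
  rewrite mem_incs !inE; apply/eqP/orP => [Ha|[/eqP ->|/eqP ->]] //; last first.
  have [pa|pa] := eqVneq (pos a) (pos d.1); [left|right]; apply/eqP;
    apply: inc_pos_inj; rewrite ?Ha //.
  by move: pa; rewrite P; do 2!case: (pos _).
rewrite /coef (perm_big _ pe) /= !big_cons big_nil d1 -h12 d1 dx !eqxx !andbT.
rewrite /sg /sgn /dsrc /dtgt P; case: (pos d.2) => /=;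
  by do 2!case: (_ == x) => //=; ring.
Qed.

(** Whatever the orientation of its edge, a dart has incidence number 1 with
    its target and -1 with its source, and the two add up on a loop. *)
Lemma wval_coef x (s : seq dartT) : all (@dart _ X) s -> dim x = 0%N ->
  wval (fun e => coef e x) s =
  (count (fun d => dtgt d == x) s)%:Z - (count (fun d => dsrc d == x) s)%:Z.
Proof.
rewrite /wval => + dx; elim: s => [|d s IH] /=; first by rewrite big_nil.
move=> /andP[D A]; rewrite big_cons IH // coef_edge //.
by rewrite !PoszD; ring.
Qed.

Lemma bd_darts gamma x (s : seq dartT) : (forall e, wchain s e = gamma e) ->
  all (@dart _ X) s -> dim x = 0%N ->
  bd gamma x = (count (fun d => dtgt d == x) s)%:Z - (count (fun d => dsrc d == x) s)%:Z.
Proof.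
move=> H A dx; pose E := undup (map (@dedge _ X) s).
rewrite (@bd_seq _ E) ?undup_uniq //; last first.
  move=> e; rewrite mem_undup; apply: contraR => Ne.
  by rewrite -H (wchain_notin Ne).
rewrite -wval_coef // (@wvalE _ _ _ _ E) ?undup_uniq //; last first.
  by move=> e; rewrite mem_undup.
by apply: eq_bigr => e _; rewrite H mulrC.
Qed.

Lemma chain1_darts gamma : chain 1 gamma -> exists s : seq dartT,
  [/\ all (@dart _ X) s, forall e, wchain s e = gamma e & size s = l1norm gamma].
Proof.
move=> /chain_support[E [uE HE dE]]; rewrite (l1norm_seq uE HE).
suff [s [A C S]] : exists s : seq dartT, [/\ all (@dart _ X) s,
    forall e, wchain s e = (if e \in E then gamma e else 0) &
    size s = (\sum_(c <- E) `|gamma c|)%N].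
  exists s; split=> // e; rewrite C; case: ifP => // /negbT.
  by move=> eE; apply/eqP; rewrite eq_sym; apply: contraR eE => /HE.
elim: E uE {HE} dE => [|e E IH] /=.
  by exists [::]; rewrite big_nil; split=> // e; rewrite wchain_nil.
move=> /andP[eE uE] dE.
have [|s [A C S]] := IH uE; first by move=> c cE; apply: dE; rewrite inE cE orbT.
have [a0 [a1 [h0 h1 p0 p1 _]]] := edge_ends (dE e (mem_head _ _)).
have D : dart (a0, a1).
  by rewrite /dart /= h0 h1 (dE e (mem_head _ _)) !eqxx /=; apply: contraFneq p0 => ->.
pose d := if 0 <= gamma e then (a0, a1) else (a1, a0).
have Dd : dart d by rewrite /d; case: ifP => // _; apply: (dart_rdart D).
have Ed : dedge d = e by rewrite /d; case: ifP.
exists (nseq `|gamma e| d ++ s); split.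
- by rewrite all_cat A all_nseq Dd orbT.
- move=> e'; rewrite wchain_cat C /wchain big_nseq Ed inE (eq_sym e' e).
  case: eqVneq => [<-|ne] /=; last first.
    by rewrite iter_addr mul0rn !add0r.
  rewrite (negbTE eE) !addr0 iter_addr addr0 -mulr_natr natz /sgn /d.
  case: (leP 0 (gamma e)) => g0 /=; rewrite ?p1 ?p0.
    by rewrite mul1r gez0_abs.
  by rewrite mulN1r ltz0_abs // opprK.
- by rewrite size_cat size_nseq big_cons S.
Qed.

(** List each edge as often as its coefficient says, in the direction given by
    the sign.  The boundary being zero, each vertex is entered as often as it is
    left, and the list decomposes into closed walks. *)
Lemma cycle1_closed_walks gamma : cycle1 gamma ->
  exists ws : seq (seq dartT),
    [/\ forall q, q \in ws -> exists2 v, dim v = 0%N & walk v q v,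
        forall e, gamma e = \sum_(q <- ws) wchain q e &
        (\sum_(q <- ws) size q = l1norm gamma)%N].
Proof.
move=> [cg bg]; have [s [A C S]] := chain1_darts cg.
have [x|ws [Hw P]] := euler_decomposition A.
  have [dx|dx] := eqVneq (dim x) 0%N.
    by have := bg x; rewrite (bd_darts C A dx); lia.
  have H (g : dartT -> cell X) : (forall d, dart d -> dim (g d) = 0%N) ->
      count (fun d => g d == x) s = 0%N.
    move=> Hg; apply/eqP; rewrite -leqn0 leqNgt -has_count; apply/negP.
    case/hasP => d ds /eqP E; move: dx; rewrite -E Hg //; by move/allP: A; apply.
  by rewrite !H //; [exact: dtgt_dim|exact: dsrc_dim].
exists [seq q <- ws | q != [::]]; split.
- move=> q; rewrite mem_filter => /andP[nq /Hw[v W]]; exists v => //.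
  by case: q nq W => // d q _ [D <- _]; apply: dsrc_dim.
- move=> e; rewrite big_filter -C (wchain_perm _ P) wchain_flatten big_mkcond [RHS]big_mkcond.
  by apply: eq_bigr => q _; case: eqVneq => [->|_] //=; rewrite wchain_nil.
- rewrite big_filter -S (perm_size P) size_flatten sumnE big_map.
  by rewrite big_mkcond /=; apply: eq_bigr => -[|].
Qed.

Lemma wchain_cycle1 v p : walk v p v -> cycle1 (wchain p).
Proof.
move=> W; have A := walk_darts W; split; first split.
- apply: (@sub_finite_set _ _ [set` map (@dedge _ X) p]); last exact: finite_seq.
  by move=> e /= ; apply: contraR => /wchain_notin ->.
- move=> e H; have : e \in map (@dedge _ X) p.
    by apply: contraR H => /wchain_notin ->.
  by move=> /mapP[d dp ->]; move/allP: A => /(_ _ dp) /dartP[].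
move=> x; have [dx|dx] := eqVneq (dim x) 0%N.
  by rewrite (bd_darts _ A dx) //; have := walk_count x W; lia.
pose E := undup (map (@dedge _ X) p).
rewrite (@bd_seq _ E) ?undup_uniq //; last first.
  by move=> e; rewrite mem_undup; apply: contraR => Ne; rewrite (wchain_notin Ne).
rewrite big_seq big1 // => e; rewrite mem_undup => /mapP[d dp ->].
rewrite coef_dim ?mulr0 //; move/allP: A => /(_ _ dp) /dartP[d1 _ _].
by rewrite /dedge d1; apply: contra dx => /eqP[<-].
Qed.

Lemma l1norm_wchain p : (l1norm (wchain p) <= size p)%N.
Proof.
pose E := undup (map (@dedge _ X) p).
rewrite (@l1norm_seq _ E) ?undup_uniq //; last first.
  by move=> e; rewrite mem_undup; apply: contraR => Ne; rewrite (wchain_notin Ne).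
have sE : {subset map (@dedge _ X) p <= E} by move=> e; rewrite mem_undup.
move: (undup_uniq (map (@dedge _ X) p)) sE; rewrite -/E => uE.
elim: p {E} (E) uE => [|d p IH] E uE sE.
  by rewrite big1 // => e _; rewrite wchain_nil.
apply: (@leq_trans (\sum_(e <- E) ((dedge d == e) + `|wchain p e|))%N).
  apply: leq_sum => e _; rewrite wchain_cons.
  by case: eqP => _ /=; rewrite ?add0r // /sgn; case: ifP => _; lia.
rewrite big_split /= -[(size p).+1]add1n leq_add //; last first.
  by apply: IH => // e ep; apply: sE; rewrite inE ep orbT.
rewrite (bigD1_seq (dedge d)) ?eqxx //=; last by apply: sE; rewrite mem_head.
by rewrite big1 // => e; rewrite eq_sym => /negbTE ->.
Qed.

Lemma perm_sides n (b : 'I_n -> inc X) f : injective b ->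
  range b = [set x | high x = f /\ dim (low x) = 1%N] ->
  perm_eq [seq a <- incs f | dim (low a) == 1%N] (map b (enum 'I_n)).
Proof.
move=> bi rb; apply: uniq_perm; rewrite ?filter_uniq ?uniq_incs //.
  by rewrite map_inj_uniq ?enum_uniq.
move=> a; rewrite mem_filter mem_incs; apply/andP/mapP => [[/eqP d1 /eqP ha]|[i _ ->]].
  have : [set x | high x = f /\ dim (low x) = 1%N] a by [].
  by rewrite -rb => -[i _ <-]; exists i; rewrite // mem_enum.
have : range b (b i) by exists i.
by rewrite rb => -[-> ->].
Qed.

Lemma coef_sides n (b : 'I_n -> inc X) f e : dim f = 2%N -> injective b ->
  range b = [set x | high x = f /\ dim (low x) = 1%N] -> dim e = 1%N ->
  coef f e = \sum_(i < n) if low (b i) == e then sg (b i) else 0.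
Proof.
move=> df bi rb de.
transitivity (\sum_(a <- [seq a <- incs f | dim (low a) == 1%N] | low a == e) sg a).
  rewrite big_filter_cond /coef big_seq_cond [RHS]big_seq_cond.
  apply: eq_bigl => a; rewrite mem_incs; case: (eqVneq (high a) f) => //= ->.
  by rewrite df de eqxx andbT; case: (eqVneq (low a) e) => [->|]; rewrite ?de ?andbF.
by rewrite (perm_big _ (perm_sides bi rb)) big_map -big_mkcond /= big_enum_cond.
Qed.

(** An attaching walk of [f].  Its base point does not matter, and its direction
    is given by the orientation of [f] through its chain. *)
Definition boundary_walk f p : Prop :=
  [/\ exists2 v, dim v = 0%N & walk v p v,
      forall e, wchain p e = coef f e,
      (size p <= size (incs f))%N &
      forall e, e \in map (@dedge _ X) p -> exists2 a, high a = f & low a = e].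

(** The dart of a side goes along its edge in the direction in which the side
    traverses it; composing the ends of the edge with the side gives the two
    corners next to it, so that consecutive darts match. *)
Lemma boundary_walk_exists f : dim f = 2%N -> exists p, boundary_walk f p.
Proof.
move=> df; have [n [b [c [n0 [bi rb] [ci rc] bc]]]] := boundary2 (complexP X) df.
case: n => // m in b c n0 bi rb ci rc bc *.
have bP i : high (b i) = f /\ dim (low (b i)) = 1%N.
  by have : range b (b i) by [exists i]; rewrite rb.
have cP i : high (c i) = f /\ dim (low (c i)) = 0%N.
  by have : range c (c i) by [exists i]; rewrite rc.
have /choice[dd Hdd] : forall i, exists d : dartT,
    [/\ dart d, dedge d = low (b i), pos d.2 = pos (b i), high d.1 = low (b i) &
        high d.2 = low (b i)].
  move=> i; have [_ d1] := bP i; have [a0 [a1 [h0 h1 p0 p1 _]]] := edge_ends d1.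
  have D : dart (a0, a1).
    by rewrite /dart /= h0 h1 d1 !eqxx /=; apply: contraFneq p0 => ->.
  case E : (pos (b i)); first by exists (a0, a1); split=> //=; rewrite p1.
  by exists (a1, a0); split => //; apply: (dart_rdart D).
have lc i a : high a = low (b i) ->
    low a = low (c (if pos a == pos (b i) then ordS i else i)).
  by move=> Ha; rewrite -bc // (low_comp (complexP X)).
have tgt i : dtgt (dd i) = low (c (ordS i)).
  by have [_ _ Pd _ h2] := Hdd i; rewrite /dtgt (lc i) // Pd eqxx.
have src i : dsrc (dd i) = low (c i).
  have [D _ Pd h1 _] := Hdd i; rewrite /dsrc (lc i) // (dart_pos D) Pd.
  by case: (pos (b i)).
pose v k := low (c (inord (k %% m.+1))).
have W k : (k <= m.+1)%N -> walk (v 0%N) (map (fun j => dd (inord j)) (iota 0 k)) (v k).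
  elim: k => [//|k IH] km; rewrite -[k.+1]addn1 iotaD map_cat; apply/walk_cat.
  exists (v k); split; first by apply: IH; lia.
  have [D _ _ _ _] := Hdd (inord k); split=> //=; rewrite ?src ?tgt /v.
    by rewrite modn_small.
  by congr (low (c _)); apply: val_inj; rewrite /= add0n addn1 !inordK ?ltn_pmod.
exists (map dd (enum 'I_m.+1)).
have Emap : map dd (enum 'I_m.+1) = map (fun j => dd (inord j)) (iota 0 m.+1).
  by rewrite -val_enum_ord -map_comp; apply: eq_map => i /=; rewrite inord_val.
split.
- exists (v 0%N); first by have [] := cP (inord (0 %% m.+1)).
  rewrite Emap; have := W m.+1 (leqnn _).
  by rewrite [X in walk _ _ X]/v modnn -[in X in walk _ _ X](mod0n m.+1).
- move=> e; have [de|de] := eqVneq (dim e) 1%N; last first.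
    rewrite coef_dim; last by rewrite df eqSS eq_sym.
    apply: wchain_notin; apply: contra de => /mapP[_ /mapP[i _ ->] ->].
    by have [_ -> _ _ _] := Hdd i; have [_ ->] := bP i.
  rewrite (coef_sides df bi rb de) /wchain big_map -big_enum /=.
  apply: eq_bigr => i _; have [_ -> Pd _ _] := Hdd i.
  by rewrite /sgn /sg Pd.
- by rewrite size_map -(size_map b) -(perm_size (perm_sides bi rb)) size_filter count_size.
- move=> e /mapP[_ /mapP[i _ ->] ->]; have [_ -> _ _ _] := Hdd i.
  by exists (b i); have [] := bP i.
Qed.

Variable bw : cell X -> seq dartT.
Hypothesis bwP : forall f, dim f = 2%N -> boundary_walk f (bw f).

(** Both directions are needed, for negative coefficients of 2-chains. *)
Definition face_walk q : Prop := exists2 f, dim f = 2%N & q = bw f \/ q = rwalk (bw f).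

Lemma face_walk_closed q : face_walk q -> exists2 v, dim v = 0%N & walk v q v.
Proof.
move=> [f df E]; have [[v dv W] _ _ _] := bwP df; exists v => //.
by case: E => ->; last exact: walk_rwalk.
Qed.

Lemma face_walk_edge q : face_walk q ->
  exists2 f, dim f = 2%N &
    forall e, e \in map (@dedge _ X) q -> exists2 a, high a = f & low a = e.
Proof.
move=> [f df E]; have [[v _ W] _ _ H] := bwP df; exists f => // e.
case: E => ->; first exact: H.
move=> /mapP[d]; rewrite /rwalk mem_rev => /mapP[d' Hd' ->] ->.
rewrite dedge_rdart; last by move/allP: (walk_darts W); apply.
by apply: H; apply: map_f.
Qed.

Lemma size_face_walk q l : (forall f, dim f = 2%N -> (size (incs f) <= l)%N) ->
  face_walk q -> (size q <= l)%N.
Proof.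
move=> Hl [f df E]; have [_ _ S _] := bwP df; apply: leq_trans (Hl f df).
by case: E => ->; rewrite ?size_rwalk.
Qed.

Lemma chain2_fills mu p : chain 2 mu -> (forall e, bd mu e = wchain p e) ->
  fills face_walk (l1norm mu) p.
Proof.
move=> /chain_support[E [uE HE dE]] H; rewrite (l1norm_seq uE HE).
suff [s [S B C]] : exists s : seq (seq dartT), [/\ (size s <= \sum_(c <- E) `|mu c|)%N,
    forall q, q \in s -> face_walk q &
    forall e, \sum_(f <- E) mu f * coef f e = \sum_(q <- s) wchain q e].
  by exists s; split=> // e; rewrite -H (bd_seq _ uE HE) C.
elim: E dE {uE HE} => [|f E IH] dE.
  by exists [::]; rewrite big_nil; split=> // e; rewrite !big_nil.
have [|s [S B C]] := IH; first by move=> c cE; apply: dE; rewrite inE cE orbT.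
have df := dE f (mem_head _ _); have [[v dv W] Wf _ _] := bwP df.
pose q := if 0 <= mu f then bw f else rwalk (bw f).
exists (nseq `|mu f| q ++ s); split.
- by rewrite size_cat size_nseq big_cons leq_add.
- move=> q'; rewrite mem_cat => /orP[|/B //]; rewrite mem_nseq => /andP[_ /eqP ->].
  by exists f; rewrite // /q; case: ifP; [left|right].
- move=> e; rewrite big_cons big_cat C /= big_nseq iter_addr addr0; congr (_ + _).
  rewrite /q; case: (leP 0 (mu f)) => m0.
    by rewrite Wf -mulr_natr natz gez0_abs // mulrC.
  by rewrite wchain_rwalk ?(walk_darts W) // Wf -mulr_natr natz ltz0_abs // mulrNN mulrC.
Qed.

Lemma chain2_of_list (fs : seq (cell X)) : all (fun f => dim f == 2%N) fs ->
  exists mu, [/\ chain 2 mu, (l1norm mu <= size fs)%N &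
    forall c, bd mu c = \sum_(f <- fs) coef f c].
Proof.
move=> A; pose mu c : int := count_mem c fs.
have H s : mu s != 0 -> s \in undup fs.
  by rewrite mem_undup -has_pred1 has_count /mu; lia.
exists mu; split.
- split=> [|c /H].
    by apply: (@sub_finite_set _ _ [set` undup fs]); [exact: H|exact: finite_seq].
  by rewrite mem_undup => cf; apply/eqP; move/allP: A; apply.
- rewrite (l1norm_seq (undup_uniq _) H) /mu.
  rewrite -[leqRHS]sum1_size -[leqRHS]big_undup_iterop_count /=.
  by apply: leq_sum => c _; rewrite Monoid.iteropE iter_addn_0 mul1n.
- move=> c; rewrite (bd_seq _ (undup_uniq _) H) /mu.
  rewrite -[RHS]big_undup_iterop_count /=; apply: eq_bigr => f _.
  by rewrite Monoid.iteropE iter_addr addr0 -mulr_natr natz mulrC.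
Qed.

End Homology.

(** * The homological Dehn function *)

Section Dehn.
Variables (R : realType) (X : complex R).

(** Filling norms are infima of sets of integers, so a bound by an integer is
    attained. *)
Lemma FV_filling (C : R) : (forall k : nat, (FV X k <= (C * k%:R)%:E)%E) ->
  exists C' : nat, forall v p, walk v p v -> exists mu,
    [/\ chain 2 mu, forall e, bd mu e = @wchain R X p e & (l1norm mu <= C' * size p)%N].
Proof.
move=> H; have [C' HC] : exists C' : nat, C <= C'%:R.
  exists (Num.bound C); have [d0|d0] := leP 0 C; first exact/ltW/archi_boundP.
  exact: le_trans (ltW d0) _.
exists C' => v p W; have lp := l1norm_wchain p.
have lt : (filling_norm (@wchain R X p) < ((C' * size p).+1%:R)%:E)%E.
  apply: (@le_lt_trans _ _ (FV X (size p))).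
    by apply: ereal_sup_ubound; exists (wchain p) => //; split=> //; apply: wchain_cycle1 W.
  apply: le_lt_trans (H _) _; rewrite lte_fin.
  apply: (@le_lt_trans _ _ (C'%:R * (size p)%:R)); first exact: ler_wpM2r.
  by rewrite -natrM ltr_nat.
have [_ [mu [cm bm] <-] ltm] := ereal_inf_lt lt.
exists mu; split=> // [e|]; first by rewrite bm.
by move: ltm; rewrite lte_fin ltr_nat ltnS.
Qed.

Lemma filling_FV (C : nat) :
  (forall gamma, @cycle1 R X gamma -> exists mu,
    [/\ chain 2 mu, bd mu = gamma & (l1norm mu <= C * l1norm gamma)%N]) ->
  forall k : nat, (FV X k <= (C%:R * k%:R)%:E)%E.
Proof.
move=> H k; apply: ge_ereal_sup => _ [gamma [cg lg] <-].
have [mu [cm bm lm]] := H gamma cg.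
apply: (@le_trans _ _ ((l1norm mu)%:R%:E)).
  by apply: ereal_inf_lbound; exists mu.
rewrite lee_fin -natrM ler_nat; apply: leq_trans lm _.
by rewrite leq_mul2l lg orbT.
Qed.

End Dehn.

(** * Fineness *)

Lemma finite_bounded_seqs (T : eqType) (D : set T) L : finite_set D ->
  finite_set [set p : seq T | (size p <= L)%N /\ forall x, x \in p -> D x].
Proof.
move=> finD; elim: L => [|L IH].
  apply: (@sub_finite_set _ _ [set [::]]); last exact: finite_set1.
  by move=> p [/= + _]; rewrite leqn0 => /nilP ->.
apply: (@sub_finite_set _ _ ([set [::]] `|` [set x :: p | x in D & p in
   [set p : seq T | (size p <= L)%N /\ forall x, x \in p -> D x]])); last first.
  by rewrite finite_setU; split; [exact: finite_set1|exact: finite_image2].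
move=> [|x p] [/= S A]; [by left|right; exists x; first by apply: A; exact: mem_head].
exists p => //; split=> // y yp; apply: A; by rewrite inE yp orbT.
Qed.

Lemma uniq_map_inj (T U : eqType) (f : T -> U) (s : seq T) :
  uniq (map f s) -> {in s &, injective f}.
Proof.
elim: s => //= z s IH /andP[zs us] x y; rewrite !inE.
move=> /predU1P[->|xs] /predU1P[->|ys] // E; last exact: IH.
  by move: zs; rewrite E map_f.
by move: zs; rewrite -E map_f.
Qed.

Section Fine.
Variables (R : realType) (X : complex R).
Local Notation dartT := (inc X * inc X)%type.
Variable bw : cell X -> seq dartT.
Hypothesis bwP : forall f, dim f = 2%N -> boundary_walk f (bw f).
Hypothesis faces_at_edge : forall e : cell X, dim e = 1%N ->
  finite_set [set f | dim f = 2%N /\ exists2 a, high a = f & low a = e].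

(** Balls for the distance that counts the faces to be crossed from one edge
    to another. *)
Fixpoint edge_ball (e : cell X) r : set (cell X) :=
  if r is r'.+1 then edge_ball e r' `|`
    [set e' | dim e' = 1%N /\ exists a b,
      [/\ dim (high a) = 2%N, high a = high b, edge_ball e r' (low a) & low b = e']]
  else [set e].

Lemma edge_ball_dim e r e' : dim e = 1%N -> edge_ball e r e' -> dim e' = 1%N.
Proof. by move=> de; elim: r e' => [|r IH] e' /= => [->|[/IH|[]]]. Qed.

Lemma edge_ball_finite e r : dim e = 1%N -> finite_set (edge_ball e r).
Proof.
move=> de; elim: r => [|r IH] /=; first exact: finite_set1.
rewrite finite_setU; split=> //.
pose F := \bigcup_(e1 in edge_ball e r)
  [set f | dim f = 2%N /\ exists2 a, high a = f & low a = e1].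
have finF : finite_set F.
  by apply: bigcup_finite => // e1 /(edge_ball_dim de); apply: faces_at_edge.
apply: (@sub_finite_set _ _ (\bigcup_(f in F) [set low b | b in [set b : inc X | high b = f]])).
  move=> e' [_ [a [b [da ab Ea <-]]]]; exists (high a); last by exists b.
  by exists (low a) => //; split=> //; exists a.
apply: bigcup_finite => // f _; apply: finite_image.
exact: (finite_boundary (complexP X)).
Qed.

Lemma edge_ball_le e r r' : (r <= r')%N -> edge_ball e r `<=` edge_ball e r'.
Proof.
move=> /subnK <-; elim: (r' - r)%N => // k IH; rewrite addSn => e' /IH H.
by left.
Qed.

Lemma face_walk_ball e r q e1 e2 : face_walk bw q -> 
  e1 \in map (@dedge _ X) q -> edge_ball e r e1 ->
  e2 \in map (@dedge _ X) q -> edge_ball e r.+1 e2.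
Proof.
move=> fq q1 E1 q2; have [f df H] := face_walk_edge bwP fq.
have [a Ha La] := H _ q1; have [b Hb Lb] := H _ q2; right; split; last first.
  by exists a, b; rewrite Ha Hb La.
have [v _ W] := face_walk_closed bwP fq.
by move: q2 => /mapP[d dq ->]; have /dartP[] : dart d by move/allP: (walk_darts W); apply.
Qed.

(** A circuit has only one dart into and one dart out of each of its vertices,
    so a cycle carried by some of its edges propagates from one to the next. *)
Lemma circuit_subcycle p (U : set (cell X)) : circuit p ->
  (forall x, dim x = 0%N ->
     count (fun d => dtgt d == x) [seq d <- p | dedge d \in U] =
     count (fun d => dsrc d == x) [seq d <- p | dedge d \in U]) ->
  forall d0, d0 \in p -> U (dedge d0) -> forall d, d \in p -> U (dedge d).
Proof.
move=> /and5P[s0 A cyc us _] bal d0 d0p Ud0.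
have next d d' : d \in p -> d' \in p -> U (dedge d) -> dtgt d = dsrc d' -> U (dedge d').
  move=> dp d'p Ud E; have D : dart d by move/allP: A; apply.
  have := bal (dtgt d) (dtgt_dim D).
  have : has (fun d1 => dtgt d1 == dtgt d) [seq d <- p | dedge d \in U].
    by apply/hasP; exists d; rewrite // mem_filter dp andbT; apply/mem_set.
  rewrite has_count => h E1; move: h; rewrite E1 -has_count => /hasP[d2].
  rewrite mem_filter => /andP[/set_mem U2 d2p] /eqP E2.
  suff <- : d2 = d' by [].
  by apply: (uniq_map_inj us) => //; rewrite E2.
case: (rot_to d0p) => i p' Ep d; rewrite -(mem_rot i) Ep => dp.
have /= : cycle (fun d d' => dtgt d == dsrc d') (rot i p) by rewrite rot_cycle.
rewrite Ep /= rcons_path => /andP[P _].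
have sub : {subset d0 :: p' <= p} by move=> z; rewrite -Ep mem_rot.
move: d0 p' P sub Ud0 dp {Ep d0p} => d0 p'.
elim: p' d0 => [|d1 p' IH] d0 /=.
  by move=> _ _ U0; rewrite inE => /eqP ->.
move=> /andP[/eqP E P] sub U0; rewrite inE => /orP[/eqP -> //|].
apply: IH => //; first by move=> z zp; apply: sub; rewrite inE zp orbT.
by apply: (next d0) => //; apply: sub; rewrite !inE eqxx ?orbT.
Qed.

(** The faces of a filling of [p] that are close to the edge [e] of [p] stop at
    some distance [r] bounded by the number of faces; those within [r] bound
    the part of [p] in a ball, which by simplicity of [p] is all of [p]. *)
Lemma circuit_in_ball p e N : circuit p -> e \in map (@dedge _ X) p ->
  fills (face_walk bw) N p -> forall d, d \in p -> edge_ball e N.+1 (dedge d).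
Proof.
move=> cp ep [s [sN Bs Hs]].
have A : all (@dart _ X) p by case/and5P: cp.
pose touch r (q : seq dartT) := `[< exists2 e1, e1 \in map (@dedge _ X) q & edge_ball e r e1 >].
have touchS r q : touch r q -> touch r.+1 q.
  by move=> /asboolP[e1 H1 H2]; apply/asboolP; exists e1 => //; left.
have [r rN stop] : exists2 r, (r <= N)%N & forall q, q \in s -> touch r.+1 q -> touch r q.
  apply: contrapT => no.
  have grow r : (r <= N.+1)%N -> (r <= count (touch r) s)%N.
    elim: r => // r IH rN; apply: leq_ltn_trans (IH (ltnW rN)) _.
    rewrite ltnNge; apply/negP => le; apply: no; exists r => // q qs tq.
    apply/negPn/negP => nt.
    have := count_predC (touch r) [seq q <- s | touch r.+1 q].
    have -> : size [seq q <- s | touch r.+1 q] = count (touch r.+1) s by rewrite size_filter.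
    rewrite count_filter.
    rewrite (eq_count (a2 := touch r)); last first.
      by move=> q' /=; apply/andP/idP => [[]|t] //; split=> //; apply: touchS.
    have : has (predC (touch r)) [seq q <- s | touch r.+1 q].
      by apply/hasP; exists q; rewrite ?mem_filter ?tq.
    by rewrite has_count; lia.
  by have := grow N.+1 (leqnn _); have := count_size (touch N.+1) s; lia.
pose s1 := [seq q <- s | touch r q]; pose U := edge_ball e r.+1.
pose p1 := [seq d <- p | dedge d \in U].
have Hs1 e' : wchain p1 e' = \sum_(q <- s1) wchain q e'.
  have -> : wchain p1 e' = if e' \in U then wchain p e' else 0.
    rewrite /wchain big_filter big_mkcond /=; case: ifP => He.
      by apply: eq_bigr => d _; case: eqVneq => [->|]; rewrite ?He //; case: ifP.
    by rewrite big1 // => d _; case: eqVneq => [->|]; rewrite ?He //; case: ifP.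
  rewrite /s1 big_filter; case: ifP => [/set_mem Ue|/negP nU].
    rewrite Hs [RHS]big_mkcond; apply: eq_big_seq => q qs; case: ifP => // /negbT nt.
    apply: wchain_notin; apply: contra nt => eq'; apply: stop => //.
    by apply/asboolP; exists e'.
  rewrite big_seq_cond big1 // => q /andP[qs /asboolP[e1 q1 E1]].
  apply/wchain_notin/negP => q2; apply: nU; apply/mem_set.
  exact: face_walk_ball (Bs q qs) q1 E1 q2.
have [d0 d0p Ed0] := mapP ep.
have bal x : dim x = 0%N ->
    count (fun d => dtgt d == x) p1 = count (fun d => dsrc d == x) p1.
  move=> dx; have A1 : all (@dart _ X) p1.
    by apply/allP => d; rewrite mem_filter => /andP[_]; move/allP: A; apply.
  have := wval_coef A1 dx; rewrite (wval_sum _ Hs1) big_seq big1; first by lia.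
  move=> q; rewrite mem_filter => /andP[_ /Bs /(face_walk_closed bwP)[v _ W]].
  by rewrite wval_coef ?(walk_darts W) //; have := walk_count x W; lia.
move=> d dp; apply: (@edge_ball_le e r.+1) => //.
apply: (circuit_subcycle cp bal d0p) => //.
by rewrite -Ed0; apply: (@edge_ball_le e 0).
Qed.

(** The circuits of length at most [L] through [e] stay in a ball around [e]
    that is finite, since each edge is on finitely many faces. *)
Lemma fills_fine (C : nat) :
  (forall v p, dim v = 0%N -> walk v p v -> fills (face_walk bw) (C * size p) p) ->
  fine_graph X.
Proof.
move=> H e L de L0; pose D : set dartT := [set d | edge_ball e (C * L).+1 (dedge d) /\ dart d].
have finD : finite_set D.
  pose I := \bigcup_(e' in edge_ball e (C * L).+1) [set a : inc X | high a = e'].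
  have finI : finite_set I.
    apply: bigcup_finite; first exact: edge_ball_finite.
    by move=> *; apply: (finite_boundary (complexP X)).
  apply: (@sub_finite_set _ _ (I `*` I)); last exact: finite_setX.
  move=> d [E /dartP[_ h12 _]]; split; first by exists (dedge d).
  by exists (dedge d) => //=; rewrite h12.
apply: sub_finite_set (finite_bounded_seqs L finD).
move=> p /= /and3P[cp sp ep]; split=> // d dp.
have /and5P[s0 A cyc _ _] := cp; split; last by move/allP: A; apply.
suff [v dv W] : exists2 v, dim v = 0%N & walk v p v.
  apply: (circuit_in_ball cp ep _ dp); apply: fills_le (H v p dv W).
  by rewrite leq_mul2l sp orbT.
case: p s0 A cyc {cp sp ep dp} => // d0 p _ /= /andP[D0 A] P.
exists (dsrc d0); first exact: dsrc_dim.
split=> //; have gen d1 : all (@dart _ X) p ->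
    path (fun d d' => dtgt d == dsrc d') d1 (rcons p d0) -> walk (dtgt d1) p (dsrc d0).
  elim: p d1 {A P} => [|d2 p IH] d1 /=.
    by move=> _; rewrite andbT => /eqP.
  by move=> /andP[D2 A] /andP[/eqP E P]; split=> //; exact: IH.
exact: gen.
Qed.

End Fine.

(** * Cocompact actions *)

Section Orbits.
Variables (R : realType) (G : groupType) (X : complex R) (A : action G X).
Implicit Types (c e f : cell X) (a : inc X) (g h : G).

Lemma actK g c : act A g^-1%g (act A g c) = c.
Proof. by rewrite -actM mulVg act1. Qed.

Lemma actVK g c : act A g (act A g^-1%g c) = c.
Proof. by rewrite -actM mulgV act1. Qed.

Lemma actiK g a : acti A g^-1%g (acti A g a) = a.
Proof. by rewrite -actiM mulVg acti1. Qed.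

Lemma actiVK g a : acti A g (acti A g^-1%g a) = a.
Proof. by rewrite -actiM mulgV acti1. Qed.

Lemma orbit_act g c : orbit A (act A g c) = orbit A c.
Proof.
apply/seteqP; split=> _ [h _ <-].
  by exists (h * g)%g; rewrite // actM.
by exists (h * g^-1)%g; rewrite // actM actK.
Qed.

Lemma orbit_representatives (S : set (cell X)) :
  finite_set [set orbit A c | c in S] ->
  exists cs : seq (cell X), forall c, S c ->
    exists g c', [/\ c' \in cs, S c' & c = act A g c'].
Proof.
move=> fin.
pose rep O := xget None [set oc | exists2 c, oc = Some c & S c /\ orbit A c = O].
have finr : finite_set (rep @` [set orbit A c | c in S]) by apply: finite_image.
have [os Eos] := (finite_seqP _).1 finr.
exists (pmap id os) => c Sc.
have [c' [Er Sc' Eo]] : exists c', [/\ rep (orbit A c) = Some c', S c' &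
    orbit A c' = orbit A c].
  rewrite /rep; case: xgetP => [oc _ [c1 -> [Sc1 Ec1]]|N]; first by exists c1.
  by have [] := N (Some c); exists c.
have [g _ Eg] : orbit A c' c by rewrite Eo; exists 1%g; rewrite // act1.
exists g, c'; split=> //; rewrite mem_pmap map_id.
have : [set` os] (Some c') by rewrite -Eos; exists (orbit A c) => //; exists c.
by [].
Qed.

Lemma finite_orbits (S F : set (cell X)) : finite_set F ->
  (forall c, S c -> exists g c', F c' /\ c = act A g c') ->
  finite_set [set orbit A c | c in S].
Proof.
move=> finF H; apply: (@sub_finite_set _ _ [set orbit A c | c in F]).
  by move=> _ [c /H[g [c' [Fc' ->]]] <-]; exists c'; rewrite ?orbit_act.
exact: finite_image.
Qed.

Lemma size_incs_act g c : (size (incs (act A g c)) <= size (incs c))%N.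
Proof.
rewrite -(size_map (acti A g^-1%g)); apply: uniq_leq_size.
  by rewrite map_inj_uniq ?uniq_incs //; apply: can_inj (actiVK g).
by move=> _ /mapP[a + ->]; rewrite !mem_incs act_high => /eqP ->; rewrite actK.
Qed.

Lemma bounded_boundary : cocompact A ->
  exists l, forall c, (size (incs c) <= l)%N.
Proof.
move=> /orbit_representatives[cs H]; exists (\sum_(c <- cs) size (incs c))%N => c.
have [g [c' [c's _ ->]]] := H c I; apply: leq_trans (size_incs_act g c') _.
by rewrite (big_rem c') //= leq_addr.
Qed.

(** The incidences into the cells of finitely many orbits form finitely many
    orbits, and those of one orbit that involve [e] are permuted transitively by
    the stabilizer of [e]. *)
Lemma finite_faces_at_edge e : cocompact A -> finite_set (stab A e) ->
  finite_set [set f | dim f = 2%N /\ exists2 a, high a = f & low a = e].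
Proof.
move=> /orbit_representatives[cs H] fs.
pose Z (a' : inc X) := [set acti A g a' | g in [set g | act A g (low a') = e]].
have finZ a' : finite_set (Z a').
  have [[g0 Eg0]|N] := pselect (exists g, act A g (low a') = e); last first.
    apply: (@sub_finite_set _ _ set0) => //.
    by move=> _ [g /= Eg _]; apply: N; exists g.
  apply: (@sub_finite_set _ _ [set acti A s (acti A g0 a') | s in stab A e]); last first.
    exact: finite_image.
  move=> _ [g /= Eg <-]; exists (g * g0^-1)%g; last by rewrite actiM actiK.
  by rewrite /stab /= -{1}Eg0 actM actK.
pose B := \bigcup_(a' in [set` flatten (map (@incs R X) cs)]) Z a'.
apply: (@sub_finite_set _ _ [set high a | a in B]); last first.
  by apply/finite_image/bigcup_finite.
move=> f [_ [a Ha La]]; exists a => //.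
have [g [c' [c's _ Ef]]] := H f I; exists (acti A g^-1%g a).
  apply/flattenP; exists (incs c'); first exact: map_f.
  by rewrite mem_incs act_high Ha Ef actK.
by exists g; rewrite ?actiVK //= act_low actVK.
Qed.

End Orbits.

(** * Complexes with the same 1-skeleton *)

Section SameSkeleton.
Variables (R : realType) (Y X : complex R).
Variables (fc : cell Y -> cell X) (fi : inc Y -> inc X).

(** An embedding of [Y] in [X] onto a subcomplex that contains the
    1-skeleton; orientations need not be preserved. *)
Record skeleton_inclusion : Prop := SkeletonInclusion {
  fc_inj : injective fc;
  fi_inj : injective fi;
  fc_dim : forall c, dim (fc c) = dim c;
  fi_low : forall a, low (fi a) = fc (low a);
  fi_high : forall a, high (fi a) = fc (high a);
  fc_surj : forall c, (dim c <= 1)%N -> exists c', c = fc c';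
  fi_surj : forall a, (dim (high a) <= 1)%N -> exists a', a = fi a' }.

Hypothesis I : skeleton_inclusion.
Local Notation dartY := (inc Y * inc Y)%type.
Implicit Types (v w e : cell Y) (d : dartY) (p : seq dartY).

Definition fd d : inc X * inc X := (fi d.1, fi d.2).

Lemma fd_inj : injective fd.
Proof. by move=> [a b] [a' b'] [/(fi_inj I) -> /(fi_inj I) ->]. Qed.

Lemma dart_fd d : dart (fd d) = dart d.
Proof.
by rewrite /dart /= !(fi_high I) (fc_dim I) !(inj_eq (fc_inj I)) (inj_eq (fi_inj I)).
Qed.

Lemma dsrc_fd d : dsrc (fd d) = fc (dsrc d).
Proof. exact: (fi_low I). Qed.

Lemma dtgt_fd d : dtgt (fd d) = fc (dtgt d).
Proof. exact: (fi_low I). Qed.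

Lemma dedge_fd d : dedge (fd d) = fc (dedge d).
Proof. exact: (fi_high I). Qed.

Lemma walk_fd v p w : walk (fc v) (map fd p) (fc w) <-> walk v p w.
Proof.
elim: p v => [|d p IH] v /=; first by split=> [/(fc_inj I)|->].
rewrite dart_fd dsrc_fd dtgt_fd.
by split=> [[D /(fc_inj I) S /IH W]|[D S /IH W]]; split=> //; rewrite S.
Qed.

Lemma walk_lift v (q : seq (inc X * inc X)) w : walk (fc v) q (fc w) ->
  exists2 p, q = map fd p & walk v p w.
Proof.
suff lift : all (@dart _ X) q -> exists p, q = map fd p.
  by move=> W; have [p E] := lift (walk_darts W); exists p; rewrite // -walk_fd -E.
elim: q => [|d q IH] /=; first by exists [::].
move=> /andP[D /IH[p ->]]; have [d1 h12 _] := dartP D.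
have [a Ea] : exists a, d.1 = fi a by apply: (fi_surj I); rewrite d1.
have [b Eb] : exists b, d.2 = fi b by apply: (fi_surj I); rewrite -h12 d1.
by exists ((a, b) :: p); rewrite /= /fd /= -Ea -Eb; case: d {D d1 h12 Ea Eb}.
Qed.

Lemma wchain_fd p e : (forall a, pos (fi a) = pos a) ->
  wchain (map fd p) (fc e) = wchain p e.
Proof.
move=> fi_pos; rewrite /wchain big_map; apply: eq_bigr => d _.
by rewrite dedge_fd (inj_eq (fc_inj I)) /sgn /= fi_pos.
Qed.

Lemma circuit_fd p : circuit (map fd p) = circuit p.
Proof.
have E1 : all (@dart _ X) (map fd p) = all (@dart _ Y) p.
  by rewrite all_map; apply: eq_all => d /=; rewrite dart_fd.
have E2 : cycle (fun x y => @dtgt _ X x == @dsrc _ X y) (map fd p) =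
          cycle (fun x y => @dtgt _ Y x == @dsrc _ Y y) p.
  case: p {E1} => //= d p; rewrite -map_rcons path_map; apply: eq_path => d1 d2 /=.
  by rewrite dsrc_fd dtgt_fd (inj_eq (fc_inj I)).
have E3 (h : inc X * inc X -> cell X) (h' : dartY -> cell Y) :
    (forall d, h (fd d) = fc (h' d)) -> uniq (map h (map fd p)) = uniq (map h' p).
  move=> E; have -> : map h (map fd p) = map fc (map h' p).
    by rewrite -!map_comp; apply: eq_map => d /=; rewrite E.
  by rewrite map_inj_uniq //; apply: (fc_inj I).
by rewrite /circuit size_map E1 E2 (E3 _ _ dsrc_fd) (E3 _ _ dedge_fd).
Qed.

Lemma connected_skeleton : connected_complex Y <-> connected_complex X.
Proof.
split=> [[[v dv] C]|[[v dv] C]]; split.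
- by exists (fc v); rewrite (fc_dim I).
- move=> x y dx dy; have [x' Ex] : exists x', x = fc x' by apply: (fc_surj I); rewrite dx.
  have [y' Ey] : exists y', y = fc y' by apply: (fc_surj I); rewrite dy.
  subst; rewrite !(fc_dim I) in dx dy; have [p W] := C _ _ dx dy.
  by exists (map fd p); apply/walk_fd.
- have [v' Ev] : exists v', v = fc v' by apply: (fc_surj I); rewrite dv.
  by exists v'; rewrite -(fc_dim I) -Ev.
- move=> x y dx dy; rewrite -!(fc_dim I) in dx dy; have [q W] := C _ _ dx dy.
  by have [p _ W'] := walk_lift W; exists p.
Qed.

Lemma dist_skeleton v w : connected_complex Y -> dim v = 0%N -> dim w = 0%N ->
  dist (fc v) (fc w) = dist v w.
Proof.
move=> cY dv dw; have cX := connected_skeleton.1 cY.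
have dv' : dim (fc v) = 0%N by rewrite (fc_dim I).
have dw' : dim (fc w) = 0%N by rewrite (fc_dim I).
apply/eqP; rewrite eqn_leq; apply/andP; split.
  have [p W <-] := dist_walk cY dv dw; rewrite -(size_map fd).
  by apply: dist_le => //; apply/walk_fd.
have [q /walk_lift[p -> W] <-] := dist_walk cX dv' dw'.
by rewrite size_map; apply: dist_le.
Qed.

Lemma four_point_skeleton D : connected_complex Y -> @four_point R X D -> @four_point R Y D.
Proof.
move=> cY H x y z w dx dy dz dw.
by have := H (fc x) (fc y) (fc z) (fc w); rewrite !(fc_dim I) !dist_skeleton //; apply.
Qed.

Lemma fine_skeleton : fine_graph X -> fine_graph Y.
Proof.
move=> H e L de L0; have := H (fc e) L; rewrite (fc_dim I) => /(_ de L0) fin.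
apply: sub_finite_set (finite_preimage (f := map fd) _ fin).
  move=> p /= /and3P[cp sp ep]; rewrite circuit_fd cp size_map sp /=.
  have [d dp ->] := mapP ep; rewrite -dedge_fd.
  by apply/map_f/map_f.
by move=> p q _ _; apply/inj_map/fd_inj.
Qed.

End SameSkeleton.

Section Skeleton.
Variables (R : realType) (X : complex R).

Definition sk_cell := {c : cell X | (dim c <= 1)%N}.
Definition sk_inc := {a : inc X | (dim (high a) <= 1)%N}.

Lemma sk_low_subproof (a : sk_inc) : (dim (low (val a)) <= 1)%N.
Proof. exact: leq_trans (ltnW (dim_lt (complexP X) (val a))) (valP a). Qed.

Definition sk_data : cellData := @CellData sk_cell (fun c => dim (val c)) sk_inc
  (fun a => exist _ (low (val a)) (sk_low_subproof a))
  (fun a => exist _ (high (val a)) (valP a))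
  (fun a b => a) (fun a => pos (val a)).

Lemma sk_no_comp (a b : inc sk_data) : high a = low b -> False.
Proof.
move=> /(congr1 val) /= E; have := dim_lt (complexP X) (val a).
have := dim_lt (complexP X) (val b); have := valP b; rewrite /= E; lia.
Qed.

Lemma sk_complex : is_complex R sk_data.
Proof.
split.
- by move=> a; apply: (dim_lt (complexP X)).
- move=> s; apply: sub_finite_set
    (finite_preimage (f := val) _ (finite_boundary (complexP X) (val s))).
    by move=> a /= <-.
  by move=> a b _ _; apply: val_inj.
- by move=> a b /sk_no_comp.
- by move=> a b /sk_no_comp.
- by move=> a b c /sk_no_comp.
- move=> [e He] /= de; have [a0 [a1 [h0 h1 p0 p1 H]]] := edge_ends de.
  have l0 : (dim (high a0) <= 1)%N by rewrite h0.
  have l1 : (dim (high a1) <= 1)%N by rewrite h1.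
  exists (exist _ a0 l0), (exist _ a1 l1); split=> //.
  apply/seteqP; split=> [[a Ha] /(congr1 val) /= /H[E|E]|_ [->|->]].
  + by left; apply: val_inj.
  + by right; apply: val_inj.
  + by apply: val_inj.
  + by apply: val_inj.
- by move=> [f Hf] /= E; exfalso; move: Hf; rewrite E.
- by move=> [f Hf] /= E; move: (leq_trans E Hf).
Qed.

Definition skeleton : complex R := Complex sk_complex.

Lemma skeleton_is_graph : is_graph skeleton.
Proof. by case. Qed.

Lemma skeleton_inclusionP : @skeleton_inclusion R skeleton X val val.
Proof.
split=> //; try exact: val_inj.
- by move=> c Hc; exists (exist _ c Hc).
- by move=> a Ha; exists (exist _ a Ha).
Qed.

Variables (G : groupType) (A : action G X).

Lemma sk_act_subproof g (c : sk_cell) : (dim (act A g (val c)) <= 1)%N.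
Proof. by rewrite act_dim; exact: (valP c). Qed.

Lemma sk_acti_subproof g (a : sk_inc) : (dim (high (acti A g (val a))) <= 1)%N.
Proof. by rewrite act_high act_dim; exact: (valP a). Qed.

Definition sk_act g (c : cell skeleton) : cell skeleton :=
  exist _ (act A g (val c)) (sk_act_subproof g c).
Definition sk_acti g (a : inc skeleton) : inc skeleton :=
  exist _ (acti A g (val a)) (sk_acti_subproof g a).

Definition sk_action : action G skeleton.
Proof.
apply: (@Action R G skeleton sk_act sk_acti).
- by move=> c; apply: val_inj; apply: act1.
- by move=> g h c; apply: val_inj; apply: actM.
- by move=> a; apply: val_inj; apply: acti1.
- by move=> g h a; apply: val_inj; apply: actiM.
- by move=> g c; apply: act_dim.
- by move=> g a; apply: val_inj; apply: act_low.
- by move=> g a; apply: val_inj; apply: act_high.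
- by move=> g a b /sk_no_comp.
Defined.

End Skeleton.

(** * Stabilizers under an equivariant inclusion *)

Section SameStabilizers.
Variables (R : realType) (G : groupType) (Y X : complex R).
Variables (AY : action G Y) (AX : action G X).
Variables (fc : cell Y -> cell X) (fi : inc Y -> inc X).
Hypothesis I : skeleton_inclusion fc fi.
Hypothesis equi : forall g c, fc (act AY g c) = act AX g (fc c).

Lemma stab_skeleton c : stab AX (fc c) = stab AY c.
Proof.
apply/seteqP; split=> g; rewrite /stab /=; first by rewrite -equi => /(fc_inj I).
by rewrite -equi => ->.
Qed.

Lemma finite_edge_stabilizers_skeleton :
  finite_edge_stabilizers AY <-> finite_edge_stabilizers AX.
Proof.
split=> H e de; last by rewrite -stab_skeleton; apply: H; rewrite (fc_dim I).
have [e' E] : exists e', e = fc e' by apply: (fc_surj I); rewrite de.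
by rewrite E stab_skeleton; apply: H; rewrite -(fc_dim I) -E.
Qed.

Lemma represents_skeleton P :
  represents_vertex_stabilizers AY P <-> represents_vertex_stabilizers AX P.
Proof.
split=> -[H1 H2 H3]; split=> // [H|v].
- by move=> /H1[v dv ->]; exists (fc v); rewrite ?(fc_dim I) ?stab_skeleton.
- move=> dv; have [v' E] : exists v', v = fc v' by apply: (fc_surj I); rewrite dv.
  by rewrite E stab_skeleton; apply: H3; rewrite -(fc_dim I) -E.
- move=> /H1[v dv ->]; have [v' E] : exists v', v = fc v' by apply: (fc_surj I); rewrite dv.
  by exists v'; rewrite -?(fc_dim I) -?E // E stab_skeleton.
- by move=> dv; rewrite -stab_skeleton; apply: H3; rewrite (fc_dim I).
Qed.

End SameStabilizers.

(** * Attaching 2-cells along short circuits *)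

Section CircuitComplex.
Variables (R : realType) (Y : complex R) (L : nat).
Hypothesis graphY : is_graph Y.
Local Notation dartT := (inc Y * inc Y)%type.

(** One 2-cell for each based and directed circuit: the symmetries of a
    polygon then permute 2-cells instead of acting on one of them. *)
Definition short_circuit := {p : seq dartT | circuit p && (size p <= L)%N}.

(** A side or a corner of a 2-cell, according to the boolean, with its
    index. *)
Definition polygon_inc :=
  {x : short_circuit * bool * nat | (x.2 < size (val x.1.1))%N}.

Implicit Types (x : polygon_inc) (p : short_circuit).

Definition face_of x : short_circuit := (val x).1.1.
Definition is_side x : bool := (val x).1.2.
Definition place x : 'I_(size (val (face_of x))) := Ordinal (valP x).
Definition dart_of x : dartT := tnth (in_tuple (val (face_of x))) (place x).

Definition mk_side p (i : 'I_(size (val p))) : polygon_inc :=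
  exist _ (p, true, val i) (ltn_ord i).
Definition mk_corner p (i : 'I_(size (val p))) : polygon_inc :=
  exist _ (p, false, val i) (ltn_ord i).

(** Seen in the boundary of a polygon, the initial end of a side is the corner
    with the same index and the final end is the next corner. *)
Definition cc_data : cellData := @CellData
  (cell Y + short_circuit)%type (fun c => match c with inl c => dim c | inr _ => 2%N end)
  (inc Y + polygon_inc)%type
  (fun a => match a with
    | inl a => inl (low a)
    | inr x => inl (if is_side x then dedge (dart_of x) else dsrc (dart_of x)) end)
  (fun a => match a with inl a => inl (high a) | inr x => inr (face_of x) end)
  (fun a b => match a, b with
    | inl a', inr x =>
        inr (mk_corner (if a' == (dart_of x).1 then place x else ordS (place x)))
    | _, _ => a end)
  (fun a => match a with inl a => pos a | inr x => pos (dart_of x).2 end).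

Lemma dart_of_mem x : dart_of x \in val (face_of x).
Proof. exact: mem_tnth. Qed.

Lemma dart_dart_of x : dart (dart_of x).
Proof.
by have /andP[/and5P[_ /allP A _ _ _] _] := valP (face_of x); apply/A/dart_of_mem.
Qed.

Lemma dart_of_nth x d0 : dart_of x = nth d0 (val (face_of x)) (place x).
Proof. exact: tnth_nth. Qed.

Lemma polygon_dim x : dim (low (inr x : inc cc_data)) = if is_side x then 1%N else 0%N.
Proof.
rewrite /=; have D := dart_dart_of x; case: ifP => _; last exact: dsrc_dim.
by have [] := dartP D.
Qed.

(** Only the ends of a side of a 2-cell can be composed with it. *)
Lemma cc_comp (P : inc cc_data -> inc cc_data -> Prop) :
  (forall (a : inc Y) x, is_side x -> high a = dedge (dart_of x) -> P (inl a) (inr x)) ->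
  forall a b : inc cc_data, high a = low b -> P a b.
Proof.
move=> H [a|x] [b|y] //=.
- move=> [E]; have := dim_lt (complexP Y) a; have := dim_lt (complexP Y) b.
  by have := graphY (high b); rewrite E; lia.
- case: ifP => [sy [E]|_ [E]]; first exact: H.
  have := dsrc_dim (dart_dart_of y); rewrite -E.
  by have := dim_lt (complexP Y) a; lia.
Qed.

Lemma dart_next p (i : 'I_(size (val p))) :
  dsrc (tnth (in_tuple (val p)) (ordS i)) = dtgt (tnth (in_tuple (val p)) i).
Proof.
have /andP[/and5P[_ _ cyc _ _] _] := valP p.
case: p i cyc => [[|d s] Hp] i /= cyc; first by case: i.
rewrite !(tnth_nth d) /=; have := pathP d cyc.
move=> /(_ i); rewrite size_rcons => /(_ (ltn_ord i)) /eqP.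
have -> : nth d (d :: rcons s d) i = nth d (d :: s) i.
  by rewrite -rcons_cons nth_rcons ltn_ord.
move=> ->; rewrite nth_rcons.
have := ltn_ord i; rewrite /= ltnS leq_eqVlt => /orP[/eqP E|lt].
  by rewrite E modnn ltnn eqxx.
by rewrite modn_small ?ltnS // lt.
Qed.

Lemma corner_low x (a : inc Y) : high a = dedge (dart_of x) ->
  low (inr (mk_corner (if a == (dart_of x).1 then place x else ordS (place x)))
       : inc cc_data) = inl (low a).
Proof.
move=> Ha /=; congr inl; have D := dart_dart_of x; rewrite /dart_of /=.
case: (eqVneq a (dart_of x).1) => [E|N].
  rewrite [in RHS]E /dsrc /dart_of; congr (low (tnth _ _).1); exact: val_inj.
have Ea : a = (dart_of x).2.
  have [d1 h12 n12] := dartP D; have P := dart_pos D.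
  have da : dim (high a) = 1%N by rewrite Ha.
  apply: inc_pos_inj => //; first by rewrite Ha /dedge h12.
  case: (eqVneq (pos a) (pos (dart_of x).1)) => [E|]; last first.
    by rewrite P; do 2!case: (pos _).
  by case/eqP: N; apply: inc_pos_inj.
have -> : place (mk_corner (ordS (place x))) = ordS (place x) by apply: val_inj.
by rewrite dart_next Ea.
Qed.

Lemma polygon_incE x :
  x = if is_side x then mk_side (place x) else mk_corner (place x).
Proof.
apply: val_inj; rewrite /is_side; case: x => [[[p []] i] Hi] //=.
Qed.

Lemma range_sides p : range (fun i => inr (@mk_side p i) : inc cc_data) =
  [set a : inc cc_data | high a = inr p :> cell cc_data /\ dim (low a) = 1%N].
Proof.
apply/seteqP; split=> [_ [i _ <-]|[a|x] []] //.
  by split=> //; rewrite polygon_dim.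
move=> [E]; rewrite polygon_dim; case S : (is_side x) => // _; subst p.
by exists (place x); rewrite // [in RHS](polygon_incE x) S.
Qed.

Lemma range_corners p : range (fun i => inr (@mk_corner p i) : inc cc_data) =
  [set a : inc cc_data | high a = inr p :> cell cc_data /\ dim (low a) = 0%N].
Proof.
apply/seteqP; split=> [_ [i _ <-]|[a|x] []] //.
  by split=> //; rewrite polygon_dim.
move=> [E]; rewrite polygon_dim; case S : (is_side x) => // _; subst p.
by exists (place x); rewrite // [in RHS](polygon_incE x) S.
Qed.

Lemma cc_complex : is_complex R cc_data.
Proof.
split.
- move=> [a|x]; first exact: (dim_lt (complexP Y)).
  by rewrite polygon_dim /=; case: ifP.
- move=> [c|p].
    apply: (@sub_finite_set _ _ (inl @` [set a | high a = c])); last first.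
      exact/finite_image/(finite_boundary (complexP Y)).
    by move=> [a|x] //= [E]; exists a.
  apply: (@sub_finite_set _ _ ((fun i => inr (@mk_side p i)) @` setT `|`
                               (fun i => inr (@mk_corner p i)) @` setT)).
    pose S k := [set a : inc cc_data | high a = inr p :> cell cc_data /\ dim (low a) = k].
    move=> [a|x] //= H; have := polygon_dim x; case: ifP => _ Hd.
      by left; have : S 1%N (inr x) by []; rewrite /S -range_sides.
    by right; have : S 0%N (inr x) by []; rewrite /S -range_corners.
  by rewrite finite_setU; split; apply: finite_image; exact: finite_finset.
- by apply: cc_comp => a x _ Ha; apply: corner_low.
- by apply: cc_comp.
- move=> a b c ab bc; exfalso; move: c bc.
  move: a b ab; apply: cc_comp => a x _ _ [c|y] //=.
- move=> [e|//] /= de; have [a0 [a1 [h0 h1 p0 p1 H]]] := edge_ends de.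
  exists (inl a0), (inl a1); split=> //.
  apply/seteqP; split=> [[a|x] // [/H[->|->]]|_ [->|->]] /=; try by [left|right].
  + by rewrite h0.
  + by rewrite h1.
- move=> [c|p] /= dp; first by have := graphY c; rewrite dp.
  have /andP[/andP[s0 _] _] := valP p.
  exists (size (val p)), (fun i => inr (mk_side i)), (fun i => inr (mk_corner i)).
  split=> //.
  + by split; [move=> i j [] /val_inj | exact: range_sides].
  + by split; [move=> i j [] /val_inj | exact: range_corners].
  move=> i [a|x] // [Ha].
  have Pd : (pos a == pos (dart_of (mk_side i)).2) = (a != (dart_of (mk_side i)).1).
    have D := dart_dart_of (mk_side i); have [d1 h12 n12] := dartP D.
    have P := dart_pos D; have da : dim (high a) = 1%N by rewrite Ha.
    case: (eqVneq a (dart_of (mk_side i)).1) => [->|N] /=.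
      by rewrite P; case: (pos _).
    apply: contra_neqT N => /negbTE N; apply: inc_pos_inj => //.
    by move: N; rewrite P; do 2!case: (pos _).
  rewrite /= Pd; case: eqVneq => _ /=; congr inr; congr mk_corner; exact: val_inj.
- by move=> [c|p] //=; have := graphY c; lia.
Qed.

End CircuitComplex.

Section CircuitComplexTheory.
Variables (R : realType) (Y : complex R) (L : nat).
Hypothesis graphY : is_graph Y.
Local Notation dartT := (inc Y * inc Y)%type.
Local Notation cc := (@cc_data R Y L).

Definition circuit_complex : complex R := Complex (cc_complex L graphY).

Lemma circuit_complex_inclusion :
  @skeleton_inclusion R Y circuit_complex inl inl.
Proof.
split=> //; try by move=> a b [].
- by move=> [c|p] // _; exists c.
- by move=> [a|x] // _; exists a.
Qed.

Lemma coef_circuit (p : short_circuit Y L) (e : cell Y) : dim e = 1%N ->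
  @coef R circuit_complex (inr p) (inl e) = wchain (val p) e.
Proof.
move=> de.
have inj : injective (fun i => inr (@mk_side R Y L p i) : inc circuit_complex).
  by move=> i j [] /val_inj.
rewrite (@coef_sides R circuit_complex _ _ (inr p) (inl e) _ inj (@range_sides R Y L p)) //.
rewrite /wchain [RHS]big_tnth; apply: eq_bigr => i _.
have E : dart_of (mk_side i) = tnth (in_tuple (val p)) i.
  by rewrite /dart_of; congr tnth; exact: val_inj.
by rewrite -E /=.
Qed.

Lemma circuits_bound (s : seq (seq dartT)) :
  (forall q, q \in s -> circuit q /\ (size q <= L)%N) ->
  exists mu : cell circuit_complex -> int, [/\ chain 2 mu, (l1norm mu <= size s)%N &
    forall e : cell Y, dim e = 1%N -> bd mu (inl e) = \sum_(q <- s) wchain q e].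
Proof.
move=> H; pose ps : seq (short_circuit Y L) := pmap insub s.
have Eps : map val ps = s.
  rewrite /ps pmap_filter; last exact: insubK.
  apply/all_filterP/allP => q /H[cq sq].
  by rewrite isSome_insub cq sq.
have A2 : all (fun f : cell circuit_complex => dim f == 2%N) (map inr ps).
  by apply/allP => c /mapP[p _ ->].
have [mu [c2 lm bm]] := chain2_of_list A2.
exists mu; split=> //; first by move: lm; rewrite size_map -[in size s]Eps size_map.
move=> e de; rewrite bm big_map -[in RHS]Eps big_map.
by apply: eq_bigr => p _; apply: coef_circuit.
Qed.

(** A cycle lives on the 1-skeleton, hence is a sum of closed walks of [Y],
    which are filled one by one. *)
Lemma circuit_complex_filling C :
  (forall v (p : seq dartT), dim v = 0%N -> walk v p v ->
     fills (fun q => circuit q /\ (size q <= L)%N) (C * size p) p) ->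
  forall gamma, @cycle1 R circuit_complex gamma -> exists mu,
    [/\ chain 2 mu, bd mu = gamma & (l1norm mu <= C * l1norm gamma)%N].
Proof.
move=> H gamma cg; have [ws [Hw Cw Sw]] := cycle1_closed_walks cg.
have I := circuit_complex_inclusion.
have [s [ss Bs Hs]] : exists s : seq (seq dartT), [/\ (size s <= C * l1norm gamma)%N,
    forall q, q \in s -> circuit q /\ (size q <= L)%N &
    forall e, gamma (inl e) = \sum_(q <- s) wchain q e].
  have gen (g : cell Y -> int) :
      (forall e, g e = \sum_(q <- ws) wchain q (inl e : cell circuit_complex)) ->
      exists s : seq (seq dartT), [/\ (size s <= C * \sum_(q <- ws) size q)%N,
        forall q, q \in s -> circuit q /\ (size q <= L)%N &
        forall e, g e = \sum_(q <- s) wchain q e]; last first.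
    by rewrite -Sw; apply: gen => e; exact: Cw.
  elim: ws g {cg Cw Sw} Hw => [|w ws IH] g Hw E.
    by exists [::]; rewrite big_nil; split=> // e; rewrite E !big_nil.
  have [||s1 [S1 B1 C1]] := IH (fun e => \sum_(q <- ws) wchain q (inl e : cell circuit_complex)).
  - by move=> q qw; apply: Hw; rewrite inE qw orbT.
  - by [].
  have [[v|//] dv /(walk_lift I)[p Ep W]] := Hw w (mem_head _ _).
  have [s2 [S2 B2 C2]] := H v p dv W.
  exists (s2 ++ s1); split.
  - by rewrite size_cat big_cons mulnDr leq_add // Ep size_map.
  - by move=> q; rewrite mem_cat => /orP[/B2|/B1].
  - by move=> e; rewrite E big_cons big_cat /= -C1 -C2 Ep (wchain_fd I).
have [mu [c2 lm bm]] := circuits_bound Bs.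
exists mu; split=> //; last exact: leq_trans lm ss.
have [[_ dg] _] := cg.
apply/funext => -[e|p]; last first.
  have -> : gamma (inr p) = 0 by apply/eqP; apply: contraT => /dg.
  have [E [uE HE dE]] := chain_support c2; rewrite (bd_seq _ uE HE) big_seq big1 //.
  by move=> f /dE df; rewrite coef_dim ?mulr0 // df.
have [de|de] := eqVneq (dim e) 1%N; first by rewrite bm // Hs.
have -> : gamma (inl e) = 0.
  by apply/eqP; apply: contraT => /dg /= E; rewrite E eqxx in de.
have [E [uE HE dE]] := chain_support c2; rewrite (bd_seq _ uE HE) big_seq big1 //.
by move=> f /dE df; rewrite coef_dim ?mulr0 // df eqSS eq_sym.
Qed.

Variables (G : groupType) (A : action G Y).

(** The action need not preserve orientations, but it preserves circuits. *)
Lemma act_inclusion g : @skeleton_inclusion R Y Y (act A g) (acti A g).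
Proof.
split.
- exact: can_inj (actK A g).
- exact: can_inj (actiK A g).
- exact: act_dim.
- exact: act_low.
- exact: act_high.
- by move=> c _; exists (act A g^-1%g c); rewrite actVK.
- by move=> a _; exists (acti A g^-1%g a); rewrite actiVK.
Qed.

Lemma circuit_act_subproof g (p : short_circuit Y L) :
  circuit (map (fd (acti A g)) (val p)) && (size (map (fd (acti A g)) (val p)) <= L)%N.
Proof. by rewrite (circuit_fd (act_inclusion g)) size_map; exact: (valP p). Qed.

Definition circuit_act g (p : short_circuit Y L) : short_circuit Y L :=
  exist _ (map (fd (acti A g)) (val p)) (circuit_act_subproof g p).

Lemma polygon_act_subproof g (x : polygon_inc Y L) :
  ((val x).2 < size (val (circuit_act g (face_of x))))%N.
Proof. by rewrite size_map; exact: (valP x). Qed.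

Definition polygon_act g (x : polygon_inc Y L) : polygon_inc Y L :=
  exist _ (circuit_act g (face_of x), is_side x, (val x).2) (polygon_act_subproof g x).

Lemma dart_of_act g (x : polygon_inc Y L) :
  dart_of (polygon_act g x) = fd (acti A g) (dart_of x).
Proof.
rewrite (dart_of_nth _ (fd (acti A g) (dart_of x))) (dart_of_nth x (dart_of x)).
by rewrite (nth_map (dart_of x)) //; exact: (valP x).
Qed.

Definition cc_act g (c : cell circuit_complex) : cell circuit_complex :=
  match c with inl c => inl (act A g c) | inr p => inr (circuit_act g p) end.

Definition cc_acti g (a : inc circuit_complex) : inc circuit_complex :=
  match a with inl a => inl (acti A g a) | inr x => inr (polygon_act g x) end.

Lemma circuit_act1 p : circuit_act 1%g p = p.
Proof.
by apply: val_inj => /=; rewrite -[RHS]map_id; apply: eq_map => -[a b];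
  rewrite /fd /= !acti1.
Qed.

Lemma circuit_actM g h p : circuit_act (g * h)%g p = circuit_act g (circuit_act h p).
Proof.
by apply: val_inj => /=; rewrite -map_comp; apply: eq_map => -[a b];
  rewrite /fd /= !actiM.
Qed.

Definition cc_action : action G circuit_complex.
Proof.
apply: (@Action R G circuit_complex cc_act cc_acti).
- by move=> [c|p] /=; rewrite ?act1 ?circuit_act1.
- by move=> g h [c|p] /=; rewrite ?actM ?circuit_actM.
- move=> [a|x] /=; rewrite ?acti1 //; congr inr; apply: val_inj => /=.
  by rewrite circuit_act1; case: x => [[[p b] i] Hi].
- move=> g h [a|x] /=; rewrite ?actiM //; congr inr; apply: val_inj => /=.
  by rewrite circuit_actM.
- by move=> g [c|p] //=; exact: act_dim.
- move=> g [a|x] /=; first by rewrite act_low.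
  rewrite dart_of_act (dedge_fd (act_inclusion g)) (dsrc_fd (act_inclusion g)).
  by have -> : is_side (polygon_act g x) = is_side x by []; case: (is_side x).
- by move=> g [a|x] //=; rewrite act_high.
- move=> g; apply: (cc_comp graphY) => a x _ _ /=; congr inr; apply: val_inj => /=.
  rewrite dart_of_act /= (inj_eq (fi_inj (act_inclusion g))).
  by case: ifP => _ /=; rewrite ?size_map.
Defined.

(** By fineness only finitely many short circuits pass through the
    representatives of the orbits of edges. *)
Lemma circuit_complex_cocompact : (0 < L)%N -> connected_complex Y -> fine_graph Y ->
  finitely_many_edge_orbits A -> cocompact cc_action.
Proof.
move=> L0 [[v0 dv0] conY] fineY /orbit_representatives[es Hes].
pose F : set (cell circuit_complex) :=
  (inl @` [set e | e \in v0 :: es] `|`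
   inl @` [set low a | a in \bigcup_(e in [set` es]) [set a : inc Y | high a = e]]) `|`
  inr @` (\bigcup_(e in [set e | e \in es /\ dim e = 1%N])
            [set p : short_circuit Y L | e \in map (@dedge _ Y) (val p)]).
have finF : finite_set F.
  rewrite !finite_setU; split; first split.
  - by apply: finite_image; exact: finite_seq.
  - apply/finite_image/finite_image/bigcup_finite => // e _.
    exact: (finite_boundary (complexP Y)).
  apply/finite_image/bigcup_finite.
    apply: (@sub_finite_set _ _ [set` es]) => //.
    by move=> e [].
  move=> e [_ de]; apply: sub_finite_set (finite_preimage (f := val) _ (fineY e L de L0)).
    by move=> p /= ep; have /andP[-> ->] := valP p.
  by move=> p q _ _; apply: val_inj.
have Hedge e : dim e = 1%N -> exists g e', [/\ e' \in es, dim e' = 1%N & e = act A g e'].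
  exact: Hes.
apply: (finite_orbits finF) => -[c|p] _.
- have [dc|dc] := eqVneq (dim c) 1%N.
    have [g [e' [e's _ ->]]] := Hedge c dc; exists g, (inl e'); split=> //.
    by left; left; exists e' => //; rewrite /= inE e's orbT.
  have d0 : dim c = 0%N by have := graphY c; move: dc; case: (dim c) => [|[|]].
  have [[|d p] W] := conY c v0 d0 dv0.
    exists 1%g, (inl v0); split; last by rewrite act1 W.
    by left; left; exists v0 => //; exact: mem_head.
  case: W => /dartP[d1 _ _] Ed _; have [g [e' [e's _ Ee]]] := Hedge _ d1.
  exists g, (inl (low (acti A g^-1%g d.1))); split; last by rewrite /= act_low actVK -Ed.
  left; right; exists (low (acti A g^-1%g d.1)) => //.
  by exists (acti A g^-1%g d.1) => //; exists e'; rewrite //= act_high Ee actK.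
- have /andP[/and5P[s0 Ad _ _ _] _] := valP p.
  have [d dp] : exists d, d \in val p.
    by case: (val p) s0 => // d q _; exists d; exact: mem_head.
  have /dartP[d1 _ _] : dart d by move/allP: Ad; apply.
  have [g [e' [e's de' Ee]]] := Hedge _ d1.
  exists g, (act cc_action g^-1%g (inr p)); split; last by rewrite actVK.
  right; exists (circuit_act g^-1%g p) => //; exists e' => //=.
  rewrite -map_comp; apply/mapP; exists d => //=.
  by rewrite (dedge_fd (act_inclusion g^-1%g)) /dedge Ee actK.
Qed.

End CircuitComplexTheory.

(** * The equivalence *)

Lemma complex_of_hyperbolic_graph (R : realType) (G : groupType) (P : set (set G)) :
  relatively_hyperbolic R P ->
  exists (X : complex R) (A : action G X),
    one_acyclic X /\
    cocompact A /\
    (exists C : R, 0 <= C /\ forall k : nat, (FV X k <= (C * k%:R)%:E)%E) /\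
    finite_edge_stabilizers A /\
    represents_vertex_stabilizers A P.
Proof.
move=> [Y [A [[gY cY] fY [delta _ hY] [fes feo] rep]]].
have [D H4] := hyperbolic_four_point cY hY.
pose L := (4 * D.+1)%N; have L0 : (0 < L)%N by [].
have fill : forall gamma, @cycle1 R (circuit_complex L gY) gamma -> exists mu,
    [/\ chain 2 mu, bd mu = gamma & (l1norm mu <= L * l1norm gamma)%N].
  apply: circuit_complex_filling => v p dv W; rewrite mulnC.
  exact: four_point_fills_circuits H4 dv W.
have I := circuit_complex_inclusion L gY.
have equi g c : inl (act A g c) = act (cc_action L gY A) g (inl c) by [].
exists (circuit_complex L gY), (cc_action L gY A); split; [|split; [|split; [|split]]].
- split; first exact/(connected_skeleton I).
  by move=> gamma /fill[mu [c2 bm _]]; exists mu.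
- exact: circuit_complex_cocompact.
- by exists L%:R; split; [exact: ler0n|exact: filling_FV].
- exact/(finite_edge_stabilizers_skeleton I equi).
- exact/(represents_skeleton I equi).
Qed.

Lemma hyperbolic_graph_of_complex (R : realType) (G : groupType) (P : set (set G))
  (X : complex R) (A : action G X) (C : R) :
  one_acyclic X -> cocompact A -> (forall k : nat, (FV X k <= (C * k%:R)%:E)%E) ->
  finite_edge_stabilizers A -> represents_vertex_stabilizers A P ->
  relatively_hyperbolic R P.
Proof.
move=> [cX _] coc FVC fes rep.
have I := skeleton_inclusionP X.
have equi g c : val (act (sk_action A) g c) = act A g (val c) by [].
have cY : connected_complex (skeleton X) by apply/(connected_skeleton I).
have /choice[bw bwP] : forall f : cell X, exists p, dim f = 2%N -> boundary_walk f p.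
  move=> f; have [/boundary_walk_exists[p Hp]|/eqP ne] := eqVneq (dim f) 2%N.
    by exists p.
  by exists [::] => /ne.
have [l Hl] := bounded_boundary coc.
have [C' HC'] := FV_filling FVC.
have fill v p : dim v = 0%N -> walk v p v -> fills (face_walk bw) (C' * size p) p.
  move=> _ /HC'[mu [c2 bm lm]]; apply: (fills_le lm).
  exact: (chain2_fills bwP c2 bm).
have [D H4] : exists D, @four_point R X D.
  apply: (@fills_four_point R X cX l C') => x p dx W.
  apply: fills_sub (fill x p dx W) => q fq; split; first exact: (face_walk_closed bwP fq).
  exact: (size_face_walk bwP (fun f _ => Hl f) fq).
have fine : fine_graph X.
  apply: (fills_fine bwP _ fill) => e de.
  exact: finite_faces_at_edge coc (fes e de).
exists (skeleton X), (sk_action A); split.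
- by split; [exact: skeleton_is_graph|].
- exact: fine_skeleton I fine.
- by have [d d0 hd] := four_point_hyperbolic cY (four_point_skeleton I cY H4); exists d.
- split; first exact/(finite_edge_stabilizers_skeleton I equi).
  have [cs Hcs] := orbit_representatives coc.
  apply: (@finite_orbits _ _ _ (sk_action A) _ [set c | val c \in cs]).
    apply: (finite_preimage (B := [set` cs]) (f := val)) => //.
    by move=> a b _ _; apply: val_inj.
  move=> e _; have [g [c [cs' _ Ec]]] := Hcs (val e) Logic.I.
  have dc : (dim c <= 1)%N by rewrite -(act_dim A g) -Ec; exact: (valP e).
  by exists g, (exist _ c dc); split=> //; apply: val_inj.
- exact/(represents_skeleton I equi).
Qed.

Theorem theorem1p10 (R : realType) (G : groupType) (P : set (set G))
  (finP : finite_set P) (subP : forall H : set G, P H -> is_subgroup H) :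
  relatively_hyperbolic R P <->
  exists (X : complex R) (A : action G X),
    one_acyclic X /\
    cocompact A /\
    (exists C : R, 0 <= C /\ forall k : nat, (FV X k <= (C * k%:R)%:E)%E) /\
    finite_edge_stabilizers A /\
    represents_vertex_stabilizers A P.
Proof.
split; first exact: complex_of_hyperbolic_graph.
move=> [X [A [acX [coc [[C [_ FVC]] [fes rep]]]]]].
exact: hyperbolic_graph_of_complex acX coc FVC fes rep.
Qed.
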